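(* Let $1<a_{n-1}<a_n$ be integers and let $\beta\in\mathbf{C}$. Then the set of geometric slopes of $\mathcal{H}_{(1,a_{n-1},a_n)}(\beta)$ along $x_3=0$ at the origin of $\mathbf{C}^3$ (with coordinates $x_1,x_2,x_3$ corresponding to the entries $1,a_{n-1},a_n$ respectively) is exactly $$\left\{\frac{a_{n-1}}{a_{n-1}-a_n}\right\}.$$
   Context: **GKZ systems.** $A_3=\mathbf{C}\langle x_1,x_2,x_3,\partial_1,\partial_2,\partial_3\rangle$ is the Weyl algebra. For a row $A=(a_1,a_2,a_3)$ of positive integers, $I_A\subset\mathbf{C}[\partial_1,\partial_2,\partial_3]$ is the toric ideal generated by all $\partial^u-\partial^v$ with $u,v\in\mathbf{N}^3$ and $\sum a_iu_i=\sum a_iv_i$. For $\beta\in\mathbf{C}$, $H_A(\beta)$ is the left ideal of $A_3$ generated by $I_A$ and $\sum_{i=1}^3 a_ix_i\partial_i-\beta$, and $\mathcal{H}_A(\beta)=A_3/H_A(\beta)$. **Initial ideals.** Let $F=(0,0,0;1,1,1)$ and $V=(0,0,-1;0,0,1)$, viewed as weights on $(x_1,x_2,x_3;\partial_1,\partial_2,\partial_3)$. For $p>0$, $q\ge 0$ put $L=pF+qV$. For nonzero $P=\sum p_{\alpha\beta}x^\alpha\partial^\beta\in A_3$, $\mathrm{in}_L(P)=\sum p_{\alpha\beta}x^\alpha\xi^\beta\in\mathbf{C}[x_1,x_2,x_3,\xi_1,\xi_2,\xi_3]$, where the sum is over the terms of maximal $L$-weight. For a left ideal $I\subset A_3$,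 $\mathrm{in}_L(I)$ is the ideal generated by all $\mathrm{in}_L(P)$, $P\in I\setminus\{0\}$. **Geometric slopes.** Let $\sigma^L(I)$ be the ideal generated by $\mathrm{in}_L(I)$ in $\mathbf{C}\{x_1,x_2\}[x_3,\xi_1,\xi_2,\xi_3]$, where $\mathbf{C}\{\cdot\}$ denotes convergent power series at the origin. (This is the ring of germs at the origin of $\mathrm{gr}^L(\mathcal{D})$, $\mathcal{D}$ being the sheaf of holomorphic differential operators, up to renaming variables.) This ring is graded by $F$ and by $V$ ($x_1,x_2$ have degree $0$ for both; $\xi_i$ gets the weight of $\partial_i$). A real number $r$ with $-\infty<r<0$ is a geometric slope of $A_3/I$ along $x_3=0$ at the origin if, for $L=(-r)F+V$, the radical $\sqrt{\sigma^L(I)}$ is not bihomogeneous, i.e. not homogeneous with respect to both the $F$-grading and the $V$-grading. *)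

(* Defs.v *)
From HB Require Import structures.
From mathcomp Require Import all_boot all_order all_algebra.
From mathcomp Require Import ssrcomplements freeg mpoly.
From mathcomp Require Import boolp classical_sets reals.
From mathcomp Require Import complex.

Set Implicit Arguments.
Unset Strict Implicit.
Unset Printing Implicit Defensive.

Import Order.TTheory GRing.Theory Num.Theory.

Local Open Scope classical_set_scope.
Local Open Scope ring_scope.

Definition left_ideal_gen (T : nzRingType) (G : set T) : set T :=
  [set x | exists (k : nat) (a g : 'I_k -> T),
     (forall i, G (g i)) /\ x = \sum_(i < k) a i * g i].

Definition radical (T : comNzRingType) (J : set T) : set T :=
  [set x | exists k : nat, J (x ^+ k)].

(* An element sum p_(a,b) x^a d^b of the n-th Weyl algebra is stored as its
  total symbol sum p_(a,b) x^a xi^b, a commutative polynomial in n + n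
  variables: [lshift n i] is the index of x_i and [rshift n i] that of xi_i.
  The product is the one for which left multiplication by x_i multiplies
  symbols by x_i, and left multiplication by d_i sends a symbol q to
  xi_i q + dq/dx_i (Leibniz rule). *)

Record weyl (n : nat) (K : comNzRingType) :=
  Weyl { symb : {mpoly K[n + n]} }.

Section Weyl.
Context {n : nat} {K : comNzRingType}.
Implicit Types (p q r : {mpoly K[n + n]}) (m : 'X_{1..n + n}).

HB.instance Definition _ := [isNew for @symb n K].
HB.instance Definition _ := [Choice of weyl n K by <:].

Definition xpart m : 'X_{1..n + n} :=
  [multinom (if split k is inl _ then m k else 0%N) | k < n + n].

Definition dpart m : 'X_{1..n + n} :=
  [multinom (if split k is inr _ then m k else 0%N) | k < n + n].

Definition lmuld (i : 'I_n) q : {mpoly K[n + n]} :=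
  'X_(rshift n i) * q + q^`M(lshift n i).

Definition lmuldm m q : {mpoly K[n + n]} :=
  foldr (fun i : 'I_n => iter (m (rshift n i)) (lmuld i)) q (enum 'I_n).

Definition symb_mul p q : {mpoly K[n + n]} :=
  \sum_(m <- msupp p) p@_m *: ('X_[xpart m] * lmuldm m q).

Lemma xpartE m (i : 'I_n) :
  (xpart m (lshift n i) = m (lshift n i)) * (xpart m (rshift n i) = 0%N).
Proof.
by rewrite /xpart !mnmE -[lshift n i]/(unsplit (inl i))
  -[rshift n i]/(unsplit (inr i)) !unsplitK.
Qed.

Lemma dpartE m (i : 'I_n) :
  (dpart m (lshift n i) = 0%N) * (dpart m (rshift n i) = m (rshift n i)).
Proof.
by rewrite /dpart !mnmE -[lshift n i]/(unsplit (inl i))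
  -[rshift n i]/(unsplit (inr i)) !unsplitK.
Qed.

Lemma mnmP2 m1 m2 : (forall i : 'I_n, m1 (lshift n i) = m2 (lshift n i)) ->
  (forall i : 'I_n, m1 (rshift n i) = m2 (rshift n i)) -> m1 = m2.
Proof.
move=> hl hr; apply/mnmP => k.
by case: (split_ordP k) => i ->; [apply: hl|apply: hr].
Qed.

Lemma xdpart m : (xpart m + dpart m)%MM = m.
Proof.
by apply: mnmP2 => i; rewrite mnmDE xpartE dpartE ?addn0 ?add0n.
Qed.

Lemma lmuld_linear i : linear (lmuld i).
Proof.
by move=> c p q; rewrite /lmuld mulrDr linearP /= scalerDr -scalerAr addrACA.
Qed.
HB.instance Definition _ i := GRing.isLinear.Build K _ _ _ _ (lmuld_linear i).

Lemma lmuldm_linear m : linear (lmuldm m).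
Proof.
move=> c p q; rewrite /lmuldm; elim: (enum _) => //= i s ->.
by elim: (m _) => //= k ->; rewrite linearP.
Qed.
HB.instance Definition _ m := GRing.isLinear.Build K _ _ _ _ (lmuldm_linear m).

Lemma mderiv_xi (i j : 'I_n) :
  ('X_(rshift n j) : {mpoly K[n + n]})^`M(lshift n i) = 0.
Proof. by rewrite mderivX mnm1E eq_rlshift scale0r. Qed.

Lemma lmuldC (i j : 'I_n) q : lmuld i (lmuld j q) = lmuld j (lmuld i q).
Proof.
rewrite /lmuld !mulrDr !mderivD !mderivM !mderiv_xi !mul0r !add0r.
by rewrite mulrCA [in RHS]mderiv_comm -!addrA; congr (_ + _); rewrite addrCA.
Qed.

Lemma lmuld_lmuldm (i : 'I_n) m q : lmuld i (lmuldm m q) = lmuldm m (lmuld i q).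
Proof.
rewrite /lmuldm; elim: (enum _) => //= j s <-.
by elim: (m _) => //= k <-; rewrite lmuldC.
Qed.

Lemma eq_lmuldm m1 m2 : dpart m1 = dpart m2 -> lmuldm m1 =1 lmuldm m2.
Proof.
move=> e q; rewrite /lmuldm; elim: (enum _) => //= i s ->.
by rewrite -(dpartE m1 i).2 e (dpartE m2 i).2.
Qed.

Lemma lmuldm0 q : lmuldm 0%MM q = q.
Proof. by rewrite /lmuldm; elim: (enum _) => //= i s ->; rewrite mnm0E. Qed.

Lemma lmuldmU (i : 'I_n) m q :
  lmuldm (U_(rshift n i) + m)%MM q = lmuld i (lmuldm m q).
Proof.
rewrite /lmuldm.
have: i \in enum 'I_n by rewrite mem_enum.
have := enum_uniq 'I_n; elim: (enum _) => //= j s ih /andP[js us].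
rewrite inE mnmDE mnm1E eq_rshift; case: eqVneq => [-> _|ij /= si].
  rewrite add1n /=; congr (lmuld _ (iter _ _ _)).
  move: js {ih us}; elim: s => //= k s ih; rewrite inE negb_or => /andP[jk /ih->].
  by rewrite mnmDE mnm1E eq_rshift (negPf jk).
rewrite ih // add0n.
by elim: (m _) => //= k ->; rewrite lmuldC.
Qed.

Lemma symb_mulwE d p q : (msize p <= d)%N ->
  symb_mul p q = \sum_(m : 'X_{1..(n + n)%N < d}) p@_m *: ('X_[xpart m] * lmuldm m q).
Proof.
move=> hp; pose I : subFinType _ := 'X_{1..(n + n)%N < d}.
rewrite /symb_mul (big_mksub I) //=; first last.
  by move=> m /msize_mdeg_lt /leq_trans; apply.
  by rewrite msupp_uniq.
by rewrite big_rmcond //= => m /memN_msupp_eq0 ->; rewrite scale0r.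
Qed.

Lemma symb_mul_linl q : linear (symb_mul^~ q).
Proof.
move=> c p1 p2; pose d := maxn (msize (c *: p1 + p2)) (maxn (msize p1) (msize p2)).
rewrite !(@symb_mulwE d) ?leq_max ?leqnn ?orbT //.
rewrite scaler_sumr -big_split; apply: eq_bigr => m _ /=.
by rewrite linearP /= scalerDl scalerA.
Qed.

Lemma symb_mul_linr p : linear (symb_mul p).
Proof.
move=> c q1 q2; rewrite /symb_mul scaler_sumr -big_split /=.
apply: eq_bigr => m _; rewrite linearP mulrDr -scalerAr scalerDr.
by rewrite !scalerA mulrC.
Qed.
HB.instance Definition _ p := GRing.isLinear.Build K _ _ _ _ (symb_mul_linr p).

Definition symb_mulr q p := symb_mul p q.
HB.instance Definition _ q :=
  GRing.isLinear.Build K _ _ _ (symb_mulr q) (symb_mul_linl q).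

Lemma symb_mulX m q : symb_mul 'X_[m] q = 'X_[xpart m] * lmuldm m q.
Proof. by rewrite /symb_mul msuppX big_seq1 mcoeffX eqxx scale1r. Qed.

Lemma symb_mul_suml (s : seq 'X_{1..n + n}) (F : 'X_{1..n + n} -> {mpoly K[n + n]}) q :
  symb_mul (\sum_(m <- s) F m) q = \sum_(m <- s) symb_mul (F m) q.
Proof. exact: (linear_sum (symb_mulr q)). Qed.

Lemma symb_mulDl p1 p2 q : symb_mul (p1 + p2) q = symb_mul p1 q + symb_mul p2 q.
Proof. exact: (linearD (symb_mulr q)). Qed.

Lemma symb_mulZl c p q : symb_mul (c *: p) q = c *: symb_mul p q.
Proof. by have := linearZ_LR (symb_mulr q) c p. Qed.

Lemma symb_mul_x m p q :
  symb_mul ('X_[xpart m] * p) q = 'X_[xpart m] * symb_mul p q.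
Proof.
rewrite (mpolyE p) mulr_sumr !symb_mul_suml mulr_sumr.
apply: eq_bigr => m' _; rewrite -scalerAr !symb_mulZl -scalerAr; congr (_ *: _).
rewrite -mpolyXD !symb_mulX mulrA -mpolyXD.
congr ('X_[_] * _).
  by apply: mnmP2 => i; rewrite ?(mnmDE, xpartE).
by apply: eq_lmuldm; apply: mnmP2 => i; rewrite !dpartE // mnmDE xpartE.
Qed.

Lemma symb_mul_d i p q : symb_mul (lmuld i p) q = lmuld i (symb_mul p q).
Proof.
rewrite (mpolyE p) linear_sum !symb_mul_suml linear_sum.
apply: eq_bigr => m _; rewrite linearZ !symb_mulZl linearZ; congr (_ *: _).
rewrite /= /lmuld -mpolyXD mderivX symb_mulDl symb_mulZl !symb_mulX.
have -> : xpart (U_(rshift n i) + m)%MM = xpart m.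
  by apply: mnmP2 => j; rewrite !xpartE // mnmDE mnm1E eq_rlshift.
have e : dpart (m - U_(lshift n i))%MM = dpart m.
  by apply: mnmP2 => j; rewrite !dpartE // mnmBE mnm1E eq_lrshift subn0.
have -> : xpart (m - U_(lshift n i))%MM = (xpart m - U_(lshift n i))%MM.
  by apply: mnmP2 => j; rewrite !(mnmBE, xpartE) // mnm1E eq_lrshift.
rewrite (eq_lmuldm e) lmuldmU mderivM mderivX xpartE -!scalerAl /lmuld.
by rewrite mulrDr -!addrA [in RHS]mulrCA; congr (_ + _); rewrite addrC.
Qed.

Lemma symb_mul_dm m p q : symb_mul (lmuldm m p) q = lmuldm m (symb_mul p q).
Proof.
rewrite /lmuldm; elim: (enum _) => //= i s <-.
by elim: (m _) => //= k <-; rewrite symb_mul_d.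
Qed.

Lemma symb_mulA : associative symb_mul.
Proof.
move=> p q r; rewrite (mpolyE p) symb_mul_suml (symb_mul_suml _ _ q) symb_mul_suml.
apply: eq_bigr => m _; rewrite !symb_mulZl; congr (_ *: _).
by rewrite !symb_mulX symb_mul_x symb_mul_dm.
Qed.

Lemma symb_mul1 q : symb_mul 1 q = q.
Proof.
rewrite -mpolyX0 symb_mulX lmuldm0.
have -> : xpart 0%MM = 0%MM by apply: mnmP2 => i; rewrite !(xpartE, mnm0E).
by rewrite mpolyX0 mul1r.
Qed.

Lemma lmuldm1 m : lmuldm m 1 = 'X_[dpart m].
Proof.
elim/(@ltmwf (n + n)): m => m ih.
have [/existsP[i mi]|/existsPn h] := boolP [exists i : 'I_n, m (rshift n i) != 0%N].
  have hm : (U_(rshift n i) + (m - U_(rshift n i)))%MM = m.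
    by rewrite addmC submK // lep1mP.
  rewrite -[in LHS]hm lmuldmU ih; last first.
    by apply: lt_mdeg_ltmc; rewrite -[X in (_ < mdeg X)%N]hm mdegD mdeg1 add1n.
  rewrite /lmuld mderivX dpartE scale0r addr0 -mpolyXD; congr 'X_[_].
  rewrite -[in RHS]hm; apply: mnmP2 => j; rewrite !(mnmDE, dpartE) //.
  by rewrite mnm1E eq_rlshift.
have e : dpart m = dpart 0%MM.
  apply: mnmP2 => i; rewrite !dpartE // mnm0E.
  by have := h i; rewrite negbK => /eqP.
rewrite (eq_lmuldm e) lmuldm0 e -mpolyX0; congr 'X_[_].
by apply: mnmP2 => i; rewrite !(dpartE, mnm0E).
Qed.

Lemma symb_mulr1 p : symb_mul p 1 = p.
Proof.
rewrite [RHS]mpolyE /symb_mul; apply: eq_bigr => m _.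
by rewrite lmuldm1 -mpolyXD xdpart.
Qed.

Implicit Types P Q : weyl n K.

Lemma symb_inj : injective (@symb n K). Proof. exact: val_inj. Qed.

Definition weyl_add P Q := Weyl (symb P + symb Q).
Definition weyl_opp P := Weyl (- symb P).
Definition weyl_mul P Q := Weyl (symb_mul (symb P) (symb Q)).

Fact weyl_addA : associative weyl_add.
Proof. by move=> P Q S; apply: symb_inj; apply: addrA. Qed.
Fact weyl_addC : commutative weyl_add.
Proof. by move=> P Q; apply: symb_inj; apply: addrC. Qed.
Fact weyl_add0 : left_id (Weyl 0) weyl_add.
Proof. by move=> P; apply: symb_inj; apply: add0r. Qed.
Fact weyl_addN : left_inverse (Weyl 0) weyl_opp weyl_add.
Proof. by move=> P; apply: symb_inj; apply: addNr. Qed.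

HB.instance Definition _ := GRing.isZmodule.Build (weyl n K)
  weyl_addA weyl_addC weyl_add0 weyl_addN.

Fact weyl_mulA : associative weyl_mul.
Proof. by move=> P Q S; apply: symb_inj; apply: symb_mulA. Qed.
Fact weyl_mul1 : left_id (Weyl 1) weyl_mul.
Proof. by move=> P; apply: symb_inj; apply: symb_mul1. Qed.
Fact weyl_mulr1 : right_id (Weyl 1) weyl_mul.
Proof. by move=> P; apply: symb_inj; apply: symb_mulr1. Qed.
Fact weyl_mulDl : left_distributive weyl_mul +%R.
Proof. by move=> P Q S; apply: symb_inj; apply: (linearD (symb_mulr _)). Qed.
Fact weyl_mulDr : right_distributive weyl_mul +%R.
Proof. by move=> P Q S; apply: symb_inj; apply: (linearD (symb_mul _)). Qed.
Fact weyl_1neq0 : Weyl 1 != 0 :> weyl n K.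
Proof. by apply/eqP => /(congr1 (@symb n K)) /eqP; rewrite /= oner_eq0. Qed.

HB.instance Definition _ := GRing.Zmodule_isNzRing.Build (weyl n K)
  weyl_mulA weyl_mul1 weyl_mulr1 weyl_mulDl weyl_mulDr weyl_1neq0.

Definition weylC (c : K) : weyl n K := Weyl c%:MP.
Definition weylx (i : 'I_n) : weyl n K := Weyl 'X_(lshift n i).
Definition weyld (i : 'I_n) : weyl n K := Weyl 'X_(rshift n i).

Fact symb_is_additive : additive (@symb n K).
Proof. by move=> P Q. Qed.
HB.instance Definition _ :=
  GRing.isAdditive.Build (weyl n K) {mpoly K[n + n]} (@symb n K) symb_is_additive.

Lemma symbM P Q : symb (P * Q) = symb_mul (symb P) (symb Q).
Proof. by []. Qed.

Lemma symb_weylx i Q : symb (weylx i * Q) = 'X_(lshift n i) * symb Q.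
Proof.
rewrite symbM symb_mulX.
have -> : xpart U_(lshift n i) = U_(lshift n i)%MM.
  by apply: mnmP2 => j; rewrite xpartE // mnm1E eq_lrshift.
rewrite (@eq_lmuldm _ 0%MM) ?lmuldm0 //.
by apply: mnmP2 => j; rewrite !dpartE // mnm0E mnm1E eq_lrshift.
Qed.

Lemma symb_weyld i Q :
  symb (weyld i * Q) = 'X_(rshift n i) * symb Q + (symb Q)^`M(lshift n i).
Proof.
rewrite symbM symb_mulX -[U_(_)%MM in LHS]addm0 lmuldmU lmuldm0.
have -> : xpart (U_(rshift n i) + 0) = 0%MM.
  by apply: mnmP2 => j; rewrite xpartE mnm0E // mnmDE mnm0E mnm1E eq_rlshift.
by rewrite mpolyX0 mul1r.
Qed.

Lemma symb_weylC c Q : symb (weylC c * Q) = c *: symb Q.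
Proof.
rewrite symbM /= -[_%:MP]mul1r mulrC mul_mpolyC -/(symb_mulr _ _) linearZ /=.
by rewrite /symb_mulr symb_mul1.
Qed.

Lemma weylC_comm c Q : weylC c * Q = Q * weylC c.
Proof.
apply: symb_inj; rewrite symb_weylC symbM /=.
by rewrite -[_%:MP]mulr1 mul_mpolyC linearZ /= symb_mulr1.
Qed.

Lemma weylx_comm i j : weylx i * weylx j = weylx j * weylx i.
Proof. by apply: symb_inj; rewrite !symb_weylx mulrC. Qed.

Lemma weyld_comm i j : weyld i * weyld j = weyld j * weyld i.
Proof. by apply: symb_inj; rewrite !symb_weyld !mderiv_xi !addr0 mulrC. Qed.

Lemma weyld_weylx i j :
  weyld i * weylx j - weylx j * weyld i = (i == j)%:R.
Proof.
apply: symb_inj.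
rewrite -[LHS]/(symb (weyld i * weylx j) - symb (weylx j * weyld i)).
rewrite symb_weyld symb_weylx mulrC addrC addKr.
rewrite mderivX mnm1E eq_lshift eq_sym; case: eqP => [->|_].
  by rewrite scale1r -[X in (X - _)%MM]add0m addmK mpolyX0.
by rewrite scale0r.
Qed.

Lemma symb_sum (I : Type) (s : seq I) (F : I -> weyl n K) :
  symb (\sum_(i <- s) F i) = \sum_(i <- s) symb (F i).
Proof. exact: (raddf_sum (@symb n K)). Qed.

Lemma weyl_normal_form P :
  P = \sum_(m <- msupp (symb P)) weylC (symb P)@_m *
        (\prod_(i < n) weylx i ^+ m (lshift n i) *
         \prod_(i < n) weyld i ^+ m (rshift n i)).
Proof.
apply: symb_inj; rewrite [LHS]mpolyE symb_sum; apply: eq_bigr => m _.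
rewrite symb_weylC; congr (_ *: _).
have hx (s : seq 'I_n) Q : symb (\prod_(i <- s) weylx i ^+ m (lshift n i) * Q) =
    \prod_(i <- s) 'X_(lshift n i) ^+ m (lshift n i) * symb Q.
  elim: s => [|i s ih]; first by rewrite !big_nil !mul1r.
  rewrite !big_cons -!mulrA -{}ih.
  by elim: (m _) => [|k ih]; rewrite ?mul1r // !exprS -!mulrA symb_weylx ih.
pose noX (p : {mpoly K[n + n]}) := forall i : 'I_n, p^`M(lshift n i) = 0.
have noXM p q : noX p -> noX q -> noX (p * q).
  by move=> hp hq i; rewrite mderivM hp hq mul0r mulr0 addr0.
have noX1 : noX 1 by move=> i; rewrite -mpolyC1 mderivC.
have noXe i k : noX ('X_(rshift n i) ^+ k).
  elim: k => [|k ih]; first by rewrite expr0.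
  by rewrite exprS; apply: noXM => // j; apply: mderiv_xi.
have noXp (s : seq 'I_n) : noX (\prod_(i <- s) 'X_(rshift n i) ^+ m (rshift n i)).
  elim: s => [|i s ih]; first by rewrite big_nil.
  by rewrite big_cons; apply: noXM.
have hd (s : seq 'I_n) : symb (\prod_(i <- s) weyld i ^+ m (rshift n i)) =
    \prod_(i <- s) 'X_(rshift n i) ^+ m (rshift n i).
  elim: s => [|i s ih]; first by rewrite !big_nil.
  have := noXp s; rewrite !big_cons -{}ih => hs.
  elim: (m _) => [|k ih]; first by rewrite !mul1r.
  rewrite !exprS -!mulrA symb_weyld ih.
  by rewrite (noXM _ _ (noXe i k) hs) addr0.
by rewrite hx hd mpolyXE_id big_split_ord.
Qed.

End Weyl.

(* A formal power series in n variables is its family of coefficients, with the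
  Cauchy product; it is convergent when it converges absolutely on some
  polydisc of radius r > 0 around the origin. *)

Record fps (n : nat) (K : comNzRingType) := FPS { fcoef : 'X_{1..n} -> K }.

Section FPS.
Context {n : nat} {K : comNzRingType}.
Implicit Types (f g h : fps n K) (m : 'X_{1..n}).

HB.instance Definition _ := gen_eqMixin (fps n K).
HB.instance Definition _ := gen_choiceMixin (fps n K).

Lemma fpsP f g : (forall m, fcoef f m = fcoef g m) -> f = g.
Proof. by case: f g => [f] [g] /= /funext ->. Qed.

Definition fps_add f g := FPS (fun m => fcoef f m + fcoef g m).
Definition fps_opp f := FPS (fun m => - fcoef f m).
Definition fps_mul f g := FPS (fun m =>
  \sum_(k : 'X_{1..n < (mdeg m).+1, (mdeg m).+1} | m == (k.1 + k.2)%MM)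
     fcoef f k.1 * fcoef g k.2).
Definition fps_of_mpoly (p : {mpoly K[n]}) : fps n K := FPS (fun m => p@_m).

Fact fps_addA : associative fps_add.
Proof. by move=> f g h; apply: fpsP => m; apply: addrA. Qed.
Fact fps_addC : commutative fps_add.
Proof. by move=> f g; apply: fpsP => m; apply: addrC. Qed.
Fact fps_add0 : left_id (fps_of_mpoly 0) fps_add.
Proof. by move=> f; apply: fpsP => m; rewrite /= mcoeff0 add0r. Qed.
Fact fps_addN : left_inverse (fps_of_mpoly 0) fps_opp fps_add.
Proof. by move=> f; apply: fpsP => m; rewrite /= mcoeff0 addNr. Qed.

HB.instance Definition _ := GRing.isZmodule.Build (fps n K)
  fps_addA fps_addC fps_add0 fps_addN.

Definition fps_trunc (d : nat) f : {mpoly K[n]} :=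
  \sum_(m : 'X_{1..n < d}) fcoef f m *: 'X_[m].

Lemma mcoeff_trunc d f m : (mdeg m < d)%N -> (fps_trunc d f)@_m = fcoef f m.
Proof. exact: mcoeff_mpoly. Qed.

Lemma fcoef_mulE (d : nat) f g m : (mdeg m < d)%N ->
  fcoef (fps_mul f g) m = (fps_trunc d f * fps_trunc d g)@_m.
Proof.
move=> md; rewrite mcoeffM /=; apply: eq_bigr => -[k1 k2] _ /=.
by rewrite !mcoeff_trunc ?(leq_trans (bmdeg _)).
Qed.

Lemma mcoeffM_congr (d : nat) (p p' q q' : {mpoly K[n]}) m :
  (forall m', (mdeg m' < d)%N -> p@_m' = p'@_m') ->
  (forall m', (mdeg m' < d)%N -> q@_m' = q'@_m') ->
  (mdeg m < d)%N -> (p * q)@_m = (p' * q')@_m.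
Proof.
move=> hp hq md; rewrite !mcoeffM; apply: eq_bigr => -[k1 k2] _ /=.
by rewrite hp ?hq ?(leq_trans (bmdeg _)).
Qed.

Lemma mcoeff_trunc_mul (d : nat) f g m : (mdeg m < d)%N ->
  (fps_trunc d (fps_mul f g))@_m = (fps_trunc d f * fps_trunc d g)@_m.
Proof. by move=> md; rewrite mcoeff_trunc // (fcoef_mulE f g md). Qed.

Fact fps_mulA : associative fps_mul.
Proof.
move=> f g h; apply: fpsP => m; pose d := (mdeg m).+1.
rewrite !(@fcoef_mulE d) //.
rewrite (mcoeffM_congr (fun _ _ => erefl) (@mcoeff_trunc_mul d g h)) // mulrA.
by rewrite -(mcoeffM_congr (@mcoeff_trunc_mul d f g) (fun _ _ => erefl)).
Qed.

Fact fps_mulC : commutative fps_mul.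
Proof.
move=> f g; apply: fpsP => m.
by rewrite !(@fcoef_mulE (mdeg m).+1) // mulrC.
Qed.

Lemma mcoeff_trunc_mpoly (d : nat) (p : {mpoly K[n]}) m : (mdeg m < d)%N ->
  (fps_trunc d (fps_of_mpoly p))@_m = p@_m.
Proof. exact: mcoeff_trunc. Qed.

Fact fps_mul1 : left_id (fps_of_mpoly 1) fps_mul.
Proof.
move=> f; apply: fpsP => m; pose d := (mdeg m).+1; rewrite (@fcoef_mulE d) //.
rewrite (mcoeffM_congr (@mcoeff_trunc_mpoly d 1) (fun _ _ => erefl)) //.
by rewrite mul1r mcoeff_trunc.
Qed.

Fact fps_mulDl : left_distributive fps_mul +%R.
Proof.
move=> f g h; apply: fpsP => m /=; rewrite -big_split /=.
by apply: eq_bigr => k _; rewrite mulrDl.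
Qed.

Fact fps_1neq0 : fps_of_mpoly 1 != 0.
Proof.
apply/eqP => /(congr1 (fun f => fcoef f 0%MM)) /= /eqP.
by rewrite mcoeff1 mcoeff0 eqxx oner_eq0.
Qed.

HB.instance Definition _ := GRing.Zmodule_isComNzRing.Build (fps n K)
  fps_mulA fps_mulC fps_mul1 fps_mulDl fps_1neq0.

Fact fps_of_mpoly_is_additive : additive fps_of_mpoly.
Proof. by move=> p q; apply: fpsP => m /=; rewrite mcoeffB. Qed.
HB.instance Definition _ := GRing.isAdditive.Build {mpoly K[n]} (fps n K)
  fps_of_mpoly fps_of_mpoly_is_additive.

Fact fps_of_mpoly_is_multiplicative : multiplicative fps_of_mpoly.
Proof. by split=> // p q; apply: fpsP => m; rewrite /= mcoeffM. Qed.
HB.instance Definition _ := GRing.isMultiplicative.Build {mpoly K[n]} (fps n K)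
  fps_of_mpoly fps_of_mpoly_is_multiplicative.

End FPS.

Section CPS.
Context (n : nat) (K : numFieldType).
Implicit Types (f g : fps n K) (m : 'X_{1..n}).

Definition fps_norm (d : nat) (r : K) f : K :=
  \sum_(m : 'X_{1..n < d}) `|fcoef f m| * r ^+ mdeg m.

Definition convergent f : Prop :=
  exists r M : K, 0 < r /\ forall d : nat, fps_norm d r f <= M.

Definition convergent_pred : pred (fps n K) := fun f => `[< convergent f >].

Lemma fps_norm_ge0 d (r : K) f : 0 < r -> 0 <= fps_norm d r f.
Proof.
by move=> r0; apply: sumr_ge0 => m _; rewrite mulr_ge0 // exprn_ge0 // ltW.
Qed.

Lemma ler_fps_norm d (r r' : K) f : 0 < r' -> r' <= r -> fps_norm d r' f <= fps_norm d r f.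
Proof.
move=> r0 rr; apply: ler_sum => m _; apply: ler_wpM2l => //.
by apply: lerXn2r => //; rewrite nnegrE ltW // (lt_le_trans r0 rr).
Qed.

Lemma fps_normB d (r : K) f g : 0 < r ->
  fps_norm d r (f - g) <= fps_norm d r f + fps_norm d r g.
Proof.
move=> r0; rewrite /fps_norm -big_split /=; apply: ler_sum => m _.
rewrite -mulrDl; apply: ler_wpM2r; first by rewrite exprn_ge0 // ltW.
exact: (ler_normB (fcoef f m) (fcoef g m)).
Qed.

Lemma ler_sum_bmnm (d : nat) m (c : K) : 0 <= c ->
  \sum_(m' : 'X_{1..n < d} | bmnm m' == m) c <= c.
Proof.
move=> c0.
have [/existsP[m0 /eqP hm0]|/existsPn h] :=
    boolP [exists m' : 'X_{1..n < d}, bmnm m' == m].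
  rewrite (bigD1 m0) ?hm0 //= big1 ?addr0 // => m' /andP[/eqP hm /eqP].
  by case; apply: val_inj; rewrite /= hm hm0.
by rewrite big_pred0 // => m'; apply/negbTE.
Qed.

Lemma fps_normM d (r : K) f g : 0 < r ->
  fps_norm d r (f * g) <= fps_norm d r f * fps_norm d r g.
Proof.
move=> r0; pose c (k : 'X_{1..n < d, d}) :=
  (`|fcoef f k.1| * r ^+ mdeg k.1) * (`|fcoef g k.2| * r ^+ mdeg k.2).
have c0 k : 0 <= c k by rewrite !mulr_ge0 // exprn_ge0 // ltW.
apply: (@le_trans _ _
    (\sum_(m : 'X_{1..n < d}) \sum_(k : 'X_{1..n < d, d} | bmnm m == (k.1 + k.2)%MM) c k)).
  apply: ler_sum => m _.
  rewrite (fcoef_mulE f g (bmdeg m)) (mcoeff_poly_mul _ _ (bmdeg m)).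
  rewrite mulrC; apply: le_trans (_ : r ^+ mdeg m * \sum_(k : 'X_{1..n < d, d} |
      bmnm m == (k.1 + k.2)%MM) `|fcoef f k.1 * fcoef g k.2| <= _).
    apply: ler_wpM2l; first by rewrite exprn_ge0 // ltW.
    apply: le_trans (ler_norm_sum _ _ _) _; apply: ler_sum => k _.
    by rewrite !mcoeff_trunc ?bmdeg.
  rewrite mulr_sumr; apply: ler_sum => k /eqP e.
  by rewrite e mdegD exprD normrM /c mulrC mulrACA.
rewrite /fps_norm mulr_suml; under [leRHS]eq_bigr do rewrite mulr_sumr.
rewrite [leRHS]pair_bigA /=.
under eq_bigr do rewrite big_mkcond.
rewrite exchange_big /=; apply: ler_sum => k _; rewrite -big_mkcond.
exact: ler_sum_bmnm.
Qed.

Lemma convergent_common f g : convergent f -> convergent g ->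
  exists r M N : K, [/\ 0 < r, forall d, fps_norm d r f <= M
                      & forall d, fps_norm d r g <= N].
Proof.
move=> [r [M [r0 hM]]] [s [N [s0 hN]]].
pose t := r * s / (r + s); have rs0 : 0 < r + s by rewrite addr_gt0.
have t0 : 0 < t by rewrite divr_gt0 ?mulr_gt0.
exists t, M, N; split=> // d.
- apply: le_trans (hM d); apply: ler_fps_norm => //.
  by rewrite ler_pdivrMr // ler_wpM2l ?ltW // ltrDr.
- apply: le_trans (hN d); apply: ler_fps_norm => //.
  by rewrite ler_pdivrMr // mulrC ler_wpM2l ?ltW // ltrDl.
Qed.

Lemma convergent_mpoly (p : {mpoly K[n]}) : convergent (fps_of_mpoly p).
Proof.
exists 1, (\sum_(m <- msupp p) `|p@_m|); split=> // d.
apply: le_trans (_ : \sum_(m' : 'X_{1..n < d}) \sum_(m <- msupp p)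
    (if bmnm m' == m then `|p@_m| else 0) <= _).
  apply: ler_sum => m' _; rewrite expr1n mulr1 /=.
  have [hm|/memN_msupp_eq0 ->] := boolP (bmnm m' \in msupp p); last first.
    by rewrite normr0; apply: sumr_ge0 => m _; case: ifP.
  rewrite (bigD1_seq _ hm) ?msupp_uniq //= eqxx lerDl.
  by apply: sumr_ge0 => m _; case: ifP.
rewrite exchange_big; apply: ler_sum => m _; rewrite -big_mkcond /=.
exact: ler_sum_bmnm.
Qed.

Fact convergent_subring : subring_closed convergent_pred.
Proof.
split; first by apply/asboolP; exact: convergent_mpoly.
- move=> f g /asboolP hf /asboolP hg; apply/asboolP.
  have [r [M [N [r0 hM hN]]]] := convergent_common hf hg.
  exists r, (M + N); split=> // d; apply: le_trans (fps_normB _ _ _ r0) _.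
  exact: lerD.
- move=> f g /asboolP hf /asboolP hg; apply/asboolP.
  have [r [M [N [r0 hM hN]]]] := convergent_common hf hg.
  exists r, (M * N); split=> // d; apply: le_trans (fps_normM _ _ _ r0) _.
  by apply: ler_pM => //; apply: fps_norm_ge0.
Qed.
HB.instance Definition _ :=
  GRing.isSubringClosed.Build (fps n K) convergent_pred convergent_subring.

Record cps := CPS { cps_val : fps n K; _ : cps_val \in convergent_pred }.

HB.instance Definition _ := [isSub for cps_val].
HB.instance Definition _ := [Choice of cps by <:].
HB.instance Definition _ := [SubChoice_isSubComNzRing of cps by <:].

Definition cps_of_mpoly (p : {mpoly K[n]}) : cps :=
  @CPS (fps_of_mpoly p) (introT (asboolP _) (convergent_mpoly p)).

Fact cps_of_mpoly_is_additive : additive cps_of_mpoly.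
Proof. by move=> p q; apply: val_inj; rewrite /= !raddfB. Qed.
HB.instance Definition _ := GRing.isAdditive.Build {mpoly K[n]} cps
  cps_of_mpoly cps_of_mpoly_is_additive.

Fact cps_of_mpoly_is_multiplicative : multiplicative cps_of_mpoly.
Proof.
by split=> [p q|]; apply: val_inj; rewrite /= ?(rmorphM, rmorph1).
Qed.
HB.instance Definition _ := GRing.isMultiplicative.Build {mpoly K[n]} cps
  cps_of_mpoly cps_of_mpoly_is_multiplicative.

End CPS.

Definition mnm_weight (k : nat) (V : nmodType) (w : 'I_k -> V)
    (m : 'X_{1..k}) : V :=
  \sum_i w i *+ m i.

Definition initial_form (k : nat) (K : nzRingType) (R : numDomainType)
    (w : 'I_k -> R) (p : {mpoly K[k]}) : {mpoly K[k]} :=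
  \sum_(m <- msupp p |
        all (fun m' => mnm_weight w m' <= mnm_weight w m) (msupp p))
     p@_m *: 'X_[m].

Definition weighted_component (k : nat) (K : nzRingType) (w : 'I_k -> int)
    (d : int) (p : {mpoly K[k]}) : {mpoly K[k]} :=
  \sum_(m <- msupp p | mnm_weight w m == d) p@_m *: 'X_[m].

Definition homogeneous_ideal (k : nat) (K : nzRingType) (w : 'I_k -> int)
    (J : set {mpoly K[k]}) : Prop :=
  forall (p : {mpoly K[k]}) (d : int), J p -> J (weighted_component w d p).

(* The slopes are taken at the origin, along the hyperplane where the last of
   the n.+1 variables, the one of index [ord_max], vanishes. *)

Section Slopes.
Context (n : nat) (K : numFieldType).

Definition weyl_F (k : 'I_(n.+1 + n.+1)) : int :=
  if split k is inr _ then 1 else 0.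

Definition weyl_V (k : 'I_(n.+1 + n.+1)) : int :=
  match split k with
  | inl i => if i == ord_max then -1 else 0
  | inr i => if i == ord_max then 1 else 0
  end.

Definition weyl_L (R : realFieldType) (p q : R) (k : 'I_(n.+1 + n.+1)) : R :=
  p * (weyl_F k)%:~R + q * (weyl_V k)%:~R.

Definition initial_ideal (R : realFieldType) (w : 'I_(n.+1 + n.+1) -> R)
    (I : set (weyl n.+1 K)) : set {mpoly K[n.+1 + n.+1]} :=
  left_ideal_gen [set initial_form w (symb P) | P in I `&` [set P | P != 0]].

(* Germs of gr^L(D) are polynomials over [cps n K] in 1 + n.+1 variables:
   [lshift n.+1 ord0] is the index of the variable x_[ord_max] of the
   hyperplane, and [rshift 1 i] that of xi_i. *)
Definition gr_F (k : 'I_(1 + n.+1)) : int :=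
  if split k is inr _ then 1 else 0.

Definition gr_V (k : 'I_(1 + n.+1)) : int :=
  match split k with
  | inl _ => -1
  | inr i => if i == ord_max then 1 else 0
  end.

Definition to_gr_germ : {mpoly K[n.+1 + n.+1]} -> {mpoly (cps n K)[1 + n.+1]} :=
  mmap (fun c : K => (cps_of_mpoly c%:MP)%:MP)
    (fun k => match split k with
              | inl i => if unlift ord_max i is Some j
                         then (cps_of_mpoly 'X_j)%:MP
                         else 'X_(lshift n.+1 ord0)
              | inr i => 'X_(rshift 1 i)
              end).

Definition sigma_ideal (R : realFieldType) (w : 'I_(n.+1 + n.+1) -> R)
    (I : set (weyl n.+1 K)) : set {mpoly (cps n K)[1 + n.+1]} :=
  left_ideal_gen (to_gr_germ @` initial_ideal w I).

Definition geometric_slopes (R : realFieldType) (I : set (weyl n.+1 K)) :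
    set R :=
  [set r | r < 0 /\
     let J := radical (sigma_ideal (weyl_L (- r) 1) I) in
     ~ (homogeneous_ideal gr_F J /\ homogeneous_ideal gr_V J)].

End Slopes.

Section GKZ.
Context (n : nat) (K : comNzRingType).

Definition toric_ideal (A : n.-tuple nat) : set {mpoly K[n]} :=
  left_ideal_gen [set f | exists u v : 'X_{1..n},
    (\sum_(i < n) tnth A i * u i = \sum_(i < n) tnth A i * v i)%N /\
    f = 'X_[u] - 'X_[v]].

Definition euler_op (A : n.-tuple nat) (beta : K) : weyl n K :=
  \sum_(i < n) (tnth A i)%:R * (weylx i * weyld i) - weylC beta.

(* [mmap weylC weyld] substitutes d_i for the i-th variable. *)
Definition hypergeometric_ideal (A : n.-tuple nat) (beta : K) :
    set (weyl n K) :=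
  left_ideal_gen
    ((mmap weylC weyld @` toric_ideal A) `|` [set euler_op A beta]).

End GKZ.

(* Main.v *)
From HB Require Import structures.
Require Import Defs.
From mathcomp Require Import all_boot all_order all_algebra.
From mathcomp Require Import ssrcomplements freeg mpoly.
From mathcomp Require Import boolp classical_sets reals.
From mathcomp Require Import complex.
From mathcomp Require Import ring lra zify.

(** Write [s = - r > 0] and [s0 = a / (b - a)], and let [J] be the radical whose
    homogeneity is in question.

    The hypergeometric ideal has a concrete description. Substituting [t ^ a_i]
    for [xi_i] in total symbols kills the toric operators, even after
    multiplication on the left by arbitrary operators, and turns right
    multiplication by the Euler operator into
    [q |-> t dq/dt + (sum a_i x_i t ^ a_i - beta) q] ([curve_subst_euler]).
    So the symbol of an element of the ideal becomes a value of this first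
    order operator ([hypergeometric_ideal_curve]). Give [t] the largest weight
    for which no [t ^ a_i] is heavier than [xi_i]. The derivation and [beta]
    are then negligible, and comparing terms of top weight shows that each
    initial form, after the substitution reduced to its top terms, is a
    multiple of the reduced Euler form [sum a_i x_i t ^ a_i]
    ([initial_form_euler_multiple]).

    Explicit initial forms put many monomials into [J]: [xi_1] always; also
    [xi_2] and [x_3 xi_3] if [s > s0]; also [xi_3] and [x_2 xi_2] if [s < s0].
    Homogeneity of [J] may be tested on generators ([homogeneous_radical]), and
    there modulo these monomials ([radical_sigma_homogeneous]). If [s > s0], a
    remaining term of an initial form involves at most one of [x_3] and [xi_3]
    and no other [xi_i], so that its [L]-weight determines both degrees. If [s < s0], a
    remaining term could involve both [x_3] and [xi_2], which have opposite
    signs in the [L]-weight; divisibility by the reduced Euler form, here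
    [a x_2 t ^ a], excludes this ([below_slope_x2]). In both cases [J] is
    bihomogeneous.

    If [s = s0], the binomial [xi_2 ^ b - xi_3 ^ a] is an initial form, whose
    terms have different [F]-degrees. Were [J] homogeneous, [xi_2] would be
    nilpotent modulo the initial ideal. But every initial form vanishes at the
    point [x = 0], [xi = (0, 1, 1)]: there [t = 1], and the reduced Euler form
    is zero because [x = 0] ([critical_initial_form_eval]). *)

Set Implicit Arguments.
Unset Strict Implicit.
Unset Printing Implicit Defensive.

Import Order.TTheory GRing.Theory Num.Theory.

Local Open Scope classical_set_scope.
Local Open Scope ring_scope.

(** * Weighted components of polynomials *)

Section WeightedComponents.
Context (k : nat) (K : nzRingType) (V : realDomainType) (w : 'I_k -> V).
Implicit Types (p q : {mpoly K[k]}) (m : 'X_{1..k}) (d : V).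

Lemma mnm_weightD m1 m2 :
  mnm_weight w (m1 + m2)%MM = mnm_weight w m1 + mnm_weight w m2.
Proof.
by rewrite /mnm_weight -big_split; apply: eq_bigr => i _; rewrite mnmDE mulrnDr.
Qed.

Lemma mnm_weight0 : mnm_weight w 0%MM = 0.
Proof. by rewrite /mnm_weight big1 // => i _; rewrite mnm0E. Qed.

Lemma mnm_weight1 (i : 'I_k) : mnm_weight w U_(i)%MM = w i.
Proof.
rewrite /mnm_weight (bigD1 i) //= mnm1E eqxx big1 ?addr0 // => j ji.
by rewrite mnm1E eq_sym (negbTE ji).
Qed.

(** With integer weights this is [weighted_component], up to conversion; real
    weights are needed for the [L]-weights. *)
Definition wcomp d p : {mpoly K[k]} :=
  \sum_(m <- msupp p | mnm_weight w m == d) p@_m *: 'X_[m].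

Definition weight_le d p := forall m, p@_m != 0 -> mnm_weight w m <= d.

Definition homogeneous_of d p := forall m, p@_m != 0 -> mnm_weight w m = d.

Lemma mcoeff_wcomp d p m :
  (wcomp d p)@_m = if mnm_weight w m == d then p@_m else 0.
Proof.
rewrite /wcomp raddf_sum /=.
under eq_bigr do rewrite mcoeffZ mcoeffX.
have [pm|pm] := boolP (m \in msupp p); last first.
  rewrite (memN_msupp_eq0 pm) if_same big_seq_cond big1 // => m' /andP[pm' _].
  by case: (eqVneq m' m) pm => [<-|_ _]; rewrite ?pm' ?mulr0.
rewrite big_mkcond (bigD1_seq m) ?msupp_uniq //= eqxx mulr1 big1 ?addr0 // => m' mm'.
by rewrite (negbTE mm') mulr0 if_same.
Qed.

Lemma wcomp_is_linear d : linear (wcomp d).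
Proof.
move=> c p q; apply/mpolyP => m; rewrite mcoeffD mcoeffZ !mcoeff_wcomp.
by case: ifP; rewrite ?mcoeffD ?mcoeffZ // mulr0 addr0.
Qed.
HB.instance Definition _ d :=
  GRing.isLinear.Build K {mpoly K[k]} {mpoly K[k]} _ (wcomp d) (wcomp_is_linear d).

Lemma wcomp_sum d (I : Type) (s : seq I) (Q : pred I) (F : I -> {mpoly K[k]}) :
  wcomp d (\sum_(i <- s | Q i) F i) = \sum_(i <- s | Q i) wcomp d (F i).
Proof. exact: (raddf_sum (wcomp d)). Qed.

Lemma homogeneous_of_wcomp d p : homogeneous_of d (wcomp d p).
Proof. by move=> m; rewrite mcoeff_wcomp; case: ifP => [/eqP|]; rewrite ?eqxx. Qed.

Lemma wcomp_homogeneous d d' p :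
  homogeneous_of d p -> wcomp d' p = if d == d' then p else 0.
Proof.
move=> hp; apply/mpolyP => m; rewrite mcoeff_wcomp.
have [pm|pm] := eqVneq p@_m 0; last first.
  by rewrite (hp _ pm); case: ifP; rewrite ?mcoeff0.
by rewrite pm if_same; case: ifP; rewrite ?mcoeff0 ?pm.
Qed.

Lemma homogeneous_ofW d p : homogeneous_of d p -> weight_le d p.
Proof. by move=> hp m /hp ->. Qed.

Lemma weight_leW d d' p : d <= d' -> weight_le d p -> weight_le d' p.
Proof. by move=> dd hp m /hp /le_trans ->. Qed.

Lemma weight_leD d p q : weight_le d p -> weight_le d q -> weight_le d (p + q).
Proof.
move=> hp hq m; rewrite mcoeffD.
have [-> |/hp //] := eqVneq p@_m 0.
by rewrite add0r; apply: hq.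
Qed.

Lemma weight_leZ d c p : weight_le d p -> weight_le d (c *: p).
Proof.
move=> hp m; rewrite mcoeffZ => h; apply: hp; apply: contraNneq h => ->.
by rewrite mulr0.
Qed.

Lemma weight_le_sum d (I : eqType) (s : seq I) (F : I -> {mpoly K[k]}) :
  (forall i, i \in s -> weight_le d (F i)) -> weight_le d (\sum_(i <- s) F i).
Proof.
move=> h; rewrite big_seq; elim/big_ind: _ => //.
- by move=> m; rewrite mcoeff0 eqxx.
- by move=> p q; apply: weight_leD.
Qed.

Lemma wcomp_lt d d' p : weight_le d p -> d < d' -> wcomp d' p = 0.
Proof.
move=> hp dd; apply/mpolyP => m; rewrite mcoeff_wcomp mcoeff0.
case: eqP => // e; have [//|/hp] := eqVneq p@_m 0.
by rewrite e leNgt dd.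
Qed.

Lemma homogeneous_ofX m : homogeneous_of (mnm_weight w m) 'X_[m].
Proof. by move=> m'; rewrite mcoeffX; case: (eqVneq m m') => [->|]; rewrite ?eqxx. Qed.

Lemma homogeneous_ofZ d c p : homogeneous_of d p -> homogeneous_of d (c *: p).
Proof.
move=> hp m; rewrite mcoeffZ => h; apply: hp; apply: contraNneq h => ->.
by rewrite mulr0.
Qed.

Lemma homogeneous_ofD d p q :
  homogeneous_of d p -> homogeneous_of d q -> homogeneous_of d (p + q).
Proof.
move=> hp hq m; rewrite mcoeffD.
have [-> |/hp //] := eqVneq p@_m 0.
by rewrite add0r; apply: hq.
Qed.

Lemma homogeneous_of_sum d (I : eqType) (s : seq I) (Q : pred I)
    (F : I -> {mpoly K[k]}) :
  (forall i, i \in s -> Q i -> homogeneous_of d (F i)) ->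
  homogeneous_of d (\sum_(i <- s | Q i) F i).
Proof.
move=> h; rewrite big_seq_cond; elim/big_ind: _ => //.
- by move=> m; rewrite mcoeff0 eqxx.
- by move=> p q; apply: homogeneous_ofD.
- by move=> i /andP[? ?]; apply: h.
Qed.

Lemma weight_le_mul d1 d2 p q :
  weight_le d1 p -> weight_le d2 q -> weight_le (d1 + d2) (p * q).
Proof.
move=> hp hq m; rewrite -mcoeff_msupp => /msuppM_le /allpairsP[[m1 m2] /=].
by rewrite !mcoeff_msupp => -[/hp h1 /hq h2 ->]; rewrite mnm_weightD lerD.
Qed.

Lemma homogeneous_of_mul d1 d2 p q :
  homogeneous_of d1 p -> homogeneous_of d2 q -> homogeneous_of (d1 + d2) (p * q).
Proof.
move=> hp hq m; rewrite -mcoeff_msupp => /msuppM_le /allpairsP[[m1 m2] /=].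
by rewrite !mcoeff_msupp => -[/hp h1 /hq h2 ->]; rewrite mnm_weightD h1 h2.
Qed.

Lemma homogeneous_of1 : homogeneous_of 0 1.
Proof. by move=> m; rewrite mcoeff1; case: (eqVneq m 0%MM) => [->|]; rewrite ?eqxx ?mnm_weight0. Qed.

Lemma homogeneous_of_exp d p j : homogeneous_of d p -> homogeneous_of (d *+ j) (p ^+ j).
Proof.
move=> hp; elim: j => [|j ih]; first exact: homogeneous_of1.
by rewrite exprS mulrS; apply: homogeneous_of_mul.
Qed.

Lemma weight_le_exp d p j : weight_le d p -> weight_le (d *+ j) (p ^+ j).
Proof.
move=> hp; elim: j => [|j ih]; first exact/homogeneous_ofW/homogeneous_of1.
by rewrite exprS mulrS; apply: weight_le_mul.
Qed.

(** A product of two monomials of weights at most [d1] and [d2] reaches the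
    weight [d1 + d2] only when both factors have the extreme weight. *)
Lemma wcomp_mul_top d1 d2 p q : weight_le d1 p -> weight_le d2 q ->
  wcomp (d1 + d2) (p * q) = wcomp d1 p * wcomp d2 q.
Proof.
move=> hp hq; apply/mpolyP => m; rewrite mcoeff_wcomp !mcoeffM.
case: eqP => [hm|hm]; last first.
  rewrite big1 // => -[k1 k2] /= /eqP e; rewrite !mcoeff_wcomp.
  case: eqP => [e1|_]; last by rewrite mul0r.
  case: eqP => [e2|_]; last by rewrite mulr0.
  by case: hm; rewrite e mnm_weightD e1 e2.
apply: eq_bigr => -[k1 k2] /= /eqP e; rewrite !mcoeff_wcomp.
have [->|/hp h1] := eqVneq p@_k1 0; first by rewrite if_same !mul0r.
have [->|/hq h2] := eqVneq q@_k2 0; first by rewrite if_same !mulr0.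
have e12 : mnm_weight w k1 + mnm_weight w k2 = d1 + d2 by rewrite -mnm_weightD -e.
have [e1 e2] : mnm_weight w k1 = d1 /\ mnm_weight w k2 = d2 by split; lra.
by rewrite e1 e2 !eqxx.
Qed.

Lemma wcomp_exp_top d p j : weight_le d p -> wcomp (d *+ j) (p ^+ j) = wcomp d p ^+ j.
Proof.
move=> hp; elim: j => [|j ih].
  by rewrite !expr0 mulr0n (wcomp_homogeneous _ homogeneous_of1) eqxx.
by rewrite !exprS mulrS wcomp_mul_top ?ih //; apply: weight_le_exp.
Qed.

(** Multiplication by a term shifts weights; by additivity this controls the
    components of any product. *)
Lemma wcomp_mulX d c m p :
  wcomp d (c *: 'X_[m] * p) = c *: 'X_[m] * wcomp (d - mnm_weight w m) p.
Proof.
rewrite -!scalerAl linearZ /=; congr (_ *: _).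
rewrite {1}(mpolyE p) mulr_sumr linear_sum /= [in RHS]/wcomp mulr_sumr.
rewrite [RHS]big_mkcond; apply: eq_bigr => m' _.
rewrite -!commr_mpolyX -!scalerAl linearZ /= -mpolyXD.
rewrite (wcomp_homogeneous _ (@homogeneous_ofX _)) mnm_weightD.
rewrite [X in _ = if X then _ else _]eq_sym subr_eq [X in _ = if X then _ else _]eq_sym.
by case: ifP => _; rewrite ?scaler0.
Qed.

Lemma top_weight p : p != 0 -> exists d, weight_le d p /\ wcomp d p != 0.
Proof.
move=> p0.
have [m0 pm0 hmax] : exists2 m0, m0 \in msupp p &
    forall m, m \in msupp p -> mnm_weight w m <= mnm_weight w m0.
  move: p0; rewrite -msupp_eq0; elim: (msupp p) => //= m [|m1 s] ih _.
    by exists m => [|m']; rewrite inE // => /eqP->.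
  have [//|m0 m0s h] := ih.
  have [le|/ltW le] := leP (mnm_weight w m) (mnm_weight w m0).
    by exists m0 => [|m']; rewrite inE ?m0s ?orbT // => /orP[/eqP->|/h].
  exists m => [|m']; first by rewrite inE eqxx.
  by rewrite inE => /orP[/eqP->//|/h h1]; apply: le_trans h1 le.
exists (mnm_weight w m0); split=> [m|]; first by rewrite -mcoeff_msupp => /hmax.
apply: contraTneq pm0 => /mpolyP/(_ m0); rewrite mcoeff_wcomp eqxx mcoeff0 => e.
by rewrite mcoeff_msupp e eqxx.
Qed.

End WeightedComponents.

(** * Homogeneity of radicals of ideals *)

Definition left_ideal (T : nzRingType) (J : set T) :=
  [/\ J 0, forall x y, J x -> J y -> J (x + y) & forall c x, J x -> J (c * x)].

Lemma left_ideal_gen_sub (T : nzRingType) (G J : set T) :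
  left_ideal J -> G `<=` J -> left_ideal_gen G `<=` J.
Proof.
move=> [J0 JD JM] GJ x [k [c [g [Gg ->]]]].
by elim/big_ind: _ => // i _; apply/JM/GJ.
Qed.

Lemma sub_left_ideal_gen (T : nzRingType) (G : set T) : G `<=` left_ideal_gen G.
Proof.
move=> x Gx; exists 1%N, (fun=> 1), (fun=> x); split=> //.
by rewrite big_ord1 mul1r.
Qed.

Lemma left_ideal_left_ideal_gen (T : nzRingType) (G : set T) :
  left_ideal (left_ideal_gen G).
Proof.
split.
- exists 0%N, (fun=> 0), (fun=> 0); split=> [[]//|]; by rewrite big_ord0.
- move=> _ _ [k [c [g [Gg ->]]]] [k' [c' [g' [Gg' ->]]]].
  exists (k + k')%N, (fun i => match split i with inl j => c j | inr j => c' j end),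
    (fun i => match split i with inl j => g j | inr j => g' j end).
  split=> [i|]; first by case: (split i).
  rewrite big_split_ord; congr (_ + _); apply: eq_bigr => i _.
    by rewrite -[lshift _ _]/(unsplit (inl i)) unsplitK.
  by rewrite -[rshift _ _]/(unsplit (inr i)) unsplitK.
- move=> d _ [k [c [g [Gg ->]]]]; exists k, (fun i => d * c i), g; split=> //.
  by rewrite mulr_sumr; apply: eq_bigr => i _; rewrite mulrA.
Qed.

Lemma left_ideal_sum (T : nzRingType) (J : set T) (I : eqType) (s : seq I)
    (Q : pred I) (F : I -> T) : left_ideal J ->
  (forall i, i \in s -> Q i -> J (F i)) -> J (\sum_(i <- s | Q i) F i).
Proof.
move=> [J0 JD _] h; rewrite big_seq_cond; elim/big_ind: _ => // i /andP[? ?].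
exact: h.
Qed.

Lemma left_idealB (T : nzRingType) (J : set T) x y :
  left_ideal J -> J x -> J y -> J (x - y).
Proof. by move=> [_ JD JM] Jx Jy; apply: JD => //; rewrite -mulN1r; apply: JM. Qed.

Lemma sub_radical (T : comNzRingType) (J : set T) : J `<=` radical J.
Proof. by move=> x Jx; exists 1%N. Qed.

(** In the binomial expansion of [(x + y) ^+ (i + j)] each term contains
    [x ^+ i] or [y ^+ j]. *)
Lemma left_ideal_radical (T : comNzRingType) (J : set T) :
  left_ideal J -> left_ideal (radical J).
Proof.
move=> [J0 JD JM]; have JMr x c : J x -> J (x * c) by rewrite mulrC; apply: JM.
have Jge x i j : (i <= j)%N -> J (x ^+ i) -> J (x ^+ j).
  by move=> ij Jx; rewrite -(subnK ij) exprD; apply: JM.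
split; first by exists 1%N.
- move=> x y [i Jx] [j Jy]; exists (i + j)%N; rewrite exprDn.
  elim/big_ind: _ => // l _; rewrite -mulr_natl; apply: (JM).
  have [le|lt] := leqP i (i + j - l); first by apply/JMr/(Jge _ i).
  by apply/JM/(Jge _ j) => //; move: lt; lia.
- by move=> c x [i Jx]; exists i; rewrite exprMn; apply: JM.
Qed.

Section HomogeneousIdeals.
Context (k : nat) (K : comNzRingType) (w : 'I_k -> int).
Implicit Types (J : set {mpoly K[k]}) (p : {mpoly K[k]}).

(** This is the largest homogeneous ideal inside [J]; since it is an ideal,
    homogeneity may be tested on generators. *)
Lemma left_ideal_homogeneous_core J :
  left_ideal J -> left_ideal [set p | forall d, J (wcomp w d p)].
Proof.
move=> JI; have [J0 JD JM] := JI; split=> [d|p q Jp Jq d|c p Jp d] /=.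
- by rewrite raddf0.
- by rewrite raddfD; apply: JD; [exact: Jp|exact: Jq].
- rewrite (mpolyE c) mulr_suml raddf_sum /=; apply: left_ideal_sum => // m _ _.
  by rewrite wcomp_mulX; apply/JM/Jp.
Qed.

(** If all components of the generators lie in the radical, then so do those
    of every element of the ideal. For [p] in the radical, the top component
    of a power [p ^+ j] is the [j]-th power of that of [p]; hence that
    component is in the radical and can be split off, which leaves fewer
    terms. *)
Lemma homogeneous_radical (G : set {mpoly K[k]}) :
  (forall g d, G g -> radical (left_ideal_gen G) (wcomp w d g)) ->
  homogeneous_ideal w (radical (left_ideal_gen G)).
Proof.
move=> hG; set J := radical _.
have JI : left_ideal J by apply/left_ideal_radical/left_ideal_left_ideal_gen.
have Jcomp p d : left_ideal_gen G p -> J (wcomp w d p).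
  move=> Gp; apply: (left_ideal_gen_sub (left_ideal_homogeneous_core JI) _ Gp) d.
  by move=> g Gg d; apply: hG.
suff main s p d : (size (msupp p) < s)%N -> J p -> J (wcomp w d p).
  by move=> p d Jp; apply: (main (size (msupp p)).+1).
elim: s p => // s ih p sp Jp.
have [->|p0] := eqVneq p 0; first by rewrite raddf0; case: JI.
have [v [pv topv]] := top_weight w p0.
have Jtop : J (wcomp w v p).
  case: Jp => j Gpj; have := Jcomp _ (v *+ j) Gpj.
  rewrite wcomp_exp_top //; case=> i; rewrite -exprM => h.
  by exists (j * i)%N.
have [<-//|vd] := eqVneq v d.
have -> : wcomp w d p = wcomp w d (p - wcomp w v p).
  rewrite raddfB /= (wcomp_homogeneous d (@homogeneous_of_wcomp _ _ _ w v p)).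
  by rewrite (negbTE vd) subr0.
apply: ih; last by apply: left_idealB.
rewrite -ltnS; apply: leq_trans sp; rewrite ltnS.
(* Some monomial of [p] cancels, so that the support shrinks. *)
have [m pm] : exists m, (wcomp w v p)@_m != 0.
  apply: contraNP topv => /forallNP h; apply/eqP/mpolyP => m; rewrite mcoeff0.
  by apply/eqP/negPn/negP; apply: h.
have hm : mnm_weight w m = v by apply: homogeneous_of_wcomp pm.
move: pm; rewrite mcoeff_wcomp hm eqxx => pm.
have subs : {subset m :: msupp (p - wcomp w v p) <= msupp p}.
  move=> m'; rewrite inE => /orP[/eqP->|]; first by rewrite mcoeff_msupp.
  rewrite !mcoeff_msupp mcoeffB mcoeff_wcomp; apply: contraNneq => ->.
  by rewrite if_same subrr.
apply: (uniq_leq_size _ subs); rewrite /= msupp_uniq andbT.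
by rewrite mcoeff_msupp mcoeffB mcoeff_wcomp hm eqxx subrr eqxx.
Qed.

End HomogeneousIdeals.

(** * Right multiplication and the monomial curve *)

Lemma mpoly_ring_ind (k : nat) (K : comNzRingType) (Q : {mpoly K[k]} -> Prop) :
  (forall c, Q c%:MP) -> (forall i, Q 'X_i) ->
  (forall p q, Q p -> Q q -> Q (p + q)) ->
  (forall p q, Q p -> Q q -> Q (p * q)) -> forall p, Q p.
Proof.
move=> QC QX QD QM p; rewrite (mpolyE p).
elim/big_ind: _ => // [|m _]; first by rewrite -mpolyC0.
rewrite -mul_mpolyC; apply: (QM) => //; rewrite mpolyXE_id.
elim/big_ind: _ => // [|i _]; first by rewrite -mpolyC1.
elim: (m i) => [|j ih]; first by rewrite expr0 -mpolyC1.
by rewrite exprS; apply: QM.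
Qed.

Lemma mulX_mderivX (k : nat) (K : comNzRingType) (i : 'I_k) m :
  'X_i * ('X_[m])^`M(i) = 'X_[m] *+ m i :> {mpoly K[k]}.
Proof.
rewrite mderivX -scalerAr scaler_nat.
have [->|mi] := eqVneq (m i) 0%N; first by rewrite !mulr0n.
by rewrite -mpolyXD addmC submK // lep1mP.
Qed.

Section RightMultiplication.
Context (n : nat) (K : comNzRingType).
Implicit Types (P Q : weyl n K).

Lemma symbD P Q : symb (P + Q) = symb P + symb Q.
Proof. by []. Qed.

Lemma symbB P Q : symb (P - Q) = symb P - symb Q.
Proof. by []. Qed.

Lemma symbMn P j : symb (P *+ j) = symb P *+ j.
Proof. exact: raddfMn. Qed.

Lemma weyl_ind (S : weyl n K -> Prop) : S 0 -> S 1 ->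
  (forall P Q, S P -> S Q -> S (P + Q)) ->
  (forall c P, S P -> S (weylC c * P)) ->
  (forall i P, S P -> S (weylx i * P)) ->
  (forall i P, S P -> S (weyld i * P)) -> forall P, S P.
Proof.
move=> S0 S1 SD SC Sx Sd P; rewrite (weyl_normal_form P).
elim/big_ind: _ => // m _; apply: SC.
set D := (X in S (_ * X)).
have hd : S D.
  rewrite {}/D; elim: (index_enum _) => [|i s ih]; rewrite ?big_nil ?big_cons //.
  elim: (m _) => [|j jh]; first by rewrite mul1r.
  by rewrite exprS -mulrA; apply: Sd.
elim: (index_enum _) => [|i s ih]; rewrite ?big_nil ?big_cons ?mul1r //.
rewrite -mulrA; elim: (m _) => [|j jh]; first by rewrite mul1r.
by rewrite exprS -mulrA; apply: Sx.
Qed.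

(** Moving [x_i] from the right to its normal place costs a derivative with
    respect to [xi_i], since [d_i x_i = x_i d_i + 1]. *)
Lemma symb_mul_weylx P i :
  symb (P * weylx i) = 'X_(lshift n i) * symb P + (symb P)^`M(rshift n i).
Proof.
elim/weyl_ind: P.
- by rewrite mul0r raddf0 mulr0 mderiv0 addr0.
- by rewrite mul1r -[symb 1]/(1 : {mpoly K[n + n]}) -mpolyC1 mderivC mpolyC1 mulr1 addr0.
- by move=> P Q hP hQ; rewrite mulrDl !symbD hP hQ mulrDr mderivD addrACA.
- move=> c P hP; rewrite -mulrA !symb_weylC hP scalerDr mderivZ.
  by rewrite -scalerAr.
- move=> j P hP; rewrite -mulrA !symb_weylx hP mulrDr mderivM.
  by rewrite mderivX mnm1E eq_lrshift scale0r mul0r add0r mulrCA.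
- move=> j P hP; rewrite -mulrA !symb_weyld hP !mulrDr !mderivD !mderivM.
  rewrite !mderivX !mnm1E eq_lshift eq_rshift mulrCA mderiv_comm -!addrA.
  rewrite eq_sym; case: eqP => [->|_]; last by rewrite !scale0r !mul0r; ring.
  by rewrite !scale1r -[X in (X - _)%MM]add0m
    -[U_(rshift _ _)%MM as X in (X - _)%MM]add0m !addmK mpolyX0; ring.
Qed.

Lemma symb_mul_weyld P i : symb (P * weyld i) = symb P * 'X_(rshift n i).
Proof.
elim/weyl_ind: P.
- by rewrite mul0r raddf0 mul0r.
- by rewrite mul1r -[symb 1]/(1 : {mpoly K[n + n]}) mul1r.
- by move=> P Q hP hQ; rewrite mulrDl !symbD hP hQ mulrDl.
- by move=> c P hP; rewrite -mulrA !symb_weylC hP scalerAl.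
- by move=> j P hP; rewrite -mulrA !symb_weylx hP mulrA.
- move=> j P hP; rewrite -mulrA !symb_weyld hP mderivM mderiv_xi mulr0 addr0.
  by rewrite mulrDl mulrA.
Qed.

(** Operators with constant coefficients act on the right of a total symbol as
    commutative polynomials in [xi]: no [x] has to be moved past them. *)
Lemma symb_mul_const_coeff P (f : {mpoly K[n]}) :
  symb (P * mmap weylC weyld f) =
  symb P * mmap (@mpolyC _ K) (fun i => 'X_(rshift n i)) f.
Proof.
rewrite /mmap !mulr_sumr symb_sum; apply: eq_bigr => m _.
rewrite mulrA -weylC_comm -mulrA symb_weylC mul_mpolyC -scalerAr; congr (_ *: _).
rewrite /mmap1; elim: (index_enum _) P => [|i s ih] P.
  by rewrite !big_nil !mulr1.
rewrite !big_cons !mulrA ih; congr (_ * _).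
elim: (m i) P => [|j jh] P; first by rewrite !mulr1.
by rewrite !exprS !mulrA jh symb_mul_weyld.
Qed.

End RightMultiplication.

Section MonomialCurve.
Context (n : nat) (K : comNzRingType) (A : n.-tuple nat) (beta : K).

(** The toric ideal is the kernel of [xi_i |-> t ^ a_i], the parametrization of
    a monomial curve; [x] is kept, so two symbols have the same image exactly when
    the operators are congruent modulo the left ideal of the toric operators. *)
Definition curve_subst : {mpoly K[n + n]} -> {mpoly K[n + 1]} :=
  mmap (@mpolyC _ K) (fun k => match split k with
    | inl i => 'X_(lshift 1 i)
    | inr i => 'X_(rshift n ord0) ^+ tnth A i
    end).

HB.instance Definition _ := GRing.RMorphism.copy curve_subst curve_subst.

Lemma curve_substD : {morph curve_subst : p q / p + q}.
Proof. exact: rmorphD. Qed.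

Lemma curve_substB : {morph curve_subst : p q / p - q}.
Proof. exact: rmorphB. Qed.

Lemma curve_substMn p j : curve_subst (p *+ j) = curve_subst p *+ j.
Proof. exact: rmorphMn. Qed.

Lemma curve_subst_sum (I : Type) (s : seq I) (F : I -> {mpoly K[n + n]}) :
  curve_subst (\sum_(i <- s) F i) = \sum_(i <- s) curve_subst (F i).
Proof. exact: rmorph_sum. Qed.

Lemma curve_substM : {morph curve_subst : p q / p * q}.
Proof. exact: rmorphM. Qed.

Lemma curve_substC c : curve_subst c%:MP = c%:MP.
Proof. exact: mmapC. Qed.

Lemma curve_subst_x i : curve_subst 'X_(lshift n i) = 'X_(lshift 1 i).
Proof.
by rewrite /curve_subst mmapX mmap1U -[lshift n i]/(unsplit (inl i)) unsplitK.
Qed.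

Lemma curve_subst_xi i :
  curve_subst 'X_(rshift n i) = 'X_(rshift n ord0) ^+ tnth A i.
Proof.
by rewrite /curve_subst mmapX mmap1U -[rshift n i]/(unsplit (inr i)) unsplitK.
Qed.

Definition curve_euler_symb : {mpoly K[n + 1]} :=
  \sum_(i < n) ('X_(lshift 1 i) * 'X_(rshift n ord0) ^+ tnth A i) *+ tnth A i.

Definition curve_euler (q : {mpoly K[n + 1]}) : {mpoly K[n + 1]} :=
  'X_(rshift n ord0) * q^`M(rshift n ord0) + (curve_euler_symb - beta%:MP) * q.

(** The chain rule for [t d/dt], as [t d(t ^ a_i)/dt = a_i t ^ a_i]. *)
Lemma curve_subst_chain (p : {mpoly K[n + n]}) :
  'X_(rshift n ord0) * (curve_subst p)^`M(rshift n ord0) =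
  \sum_(i < n) ('X_(rshift n ord0) ^+ tnth A i *
                  curve_subst p^`M(rshift n i)) *+ tnth A i.
Proof.
elim/mpoly_ring_ind: p.
- move=> c; rewrite curve_substC mderivC mulr0 big1 // => i _.
  by rewrite mderivC raddf0 mulr0 mul0rn.
- move=> k; case: (split_ordP k) => j ->.
    rewrite curve_subst_x mderivX mnm1E eq_lrshift scale0r mulr0 big1 // => i _.
    by rewrite mderivX mnm1E eq_lrshift scale0r raddf0 mulr0 mul0rn.
  rewrite curve_subst_xi mpolyXn mulX_mderivX mulmnE mnm1E eqxx mul1n (bigD1 j) //= big1 => [|i ij].
    rewrite mderivX mnm1E eqxx scale1r -[X in (X - _)%MM]add0m addmK mpolyX0.
    by rewrite rmorph1 mulr1 addr0 mpolyXn.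
  by rewrite mderivX mnm1E eq_rshift eq_sym (negbTE ij) scale0r raddf0 mulr0 mul0rn.
- move=> p q hp hq; rewrite curve_substD mderivD mulrDr hp hq -big_split /=.
  by apply: eq_bigr => i _; rewrite mderivD curve_substD mulrDr mulrnDl.
- move=> p q hp hq; rewrite curve_substM mderivM mulrDr [X in X + _]mulrA hp mulrCA hq.
  rewrite mulr_suml mulr_sumr -big_split; apply: eq_bigr => i _ /=.
  by rewrite mderivM curve_substD !curve_substM mulrnAl mulrnAr -mulrnDl -mulrA
    [curve_subst p * (_ * _)]mulrCA -mulrDr.
Qed.

Lemma curve_subst_euler (P : weyl n K) :
  curve_subst (symb (P * euler_op A beta)) = curve_euler (curve_subst (symb P)).
Proof.
rewrite /euler_op mulrBr mulr_sumr symbB symb_sum curve_substB curve_subst_sum.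
rewrite /curve_euler curve_subst_chain mulrBl addrA; congr (_ - _); last first.
  by rewrite -weylC_comm symb_weylC -mul_mpolyC curve_substM curve_substC.
rewrite /curve_euler_symb mulr_suml -big_split; apply: eq_bigr => i _.
rewrite mulr_natl mulrnAr mulrA symbMn curve_substMn.
rewrite symb_mul_weyld symb_mul_weylx curve_substM curve_substD curve_substM.
rewrite curve_subst_x curve_subst_xi /= mulrnAl -mulrnDl; congr (_ *+ _).
rewrite mulrDl addrC. by congr (_ + _); [exact: mulrAC|exact: mulrC].
Qed.

(** A left multiple of a toric operator has image zero, and a left multiple of
    the Euler operator has an image in the range of [curve_euler]. *)
Lemma hypergeometric_ideal_curve (P : weyl n K) :
  hypergeometric_ideal A beta P ->
  exists q, curve_subst (symb P) = curve_euler q.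
Proof.
move=> [k [c [g [Gg ->]]]]; rewrite symb_sum curve_subst_sum.
elim/big_ind: _ => [|p1 p2 [q1 ->] [q2 ->]|i _].
- by exists 0; rewrite /curve_euler mderiv0 !mulr0 addr0.
- by exists (q1 + q2); rewrite /curve_euler mderivD !mulrDr addrACA.
case: (Gg i) => [[f [l [d [h [hh ->]]]] <-]|->]; last first.
  by exists (curve_subst (symb (c i))); apply: curve_subst_euler.
exists 0; rewrite symb_mul_const_coeff curve_substM.
pose sb := mmap (@mpolyC (n + n) K) (fun i : 'I_n => 'X_(rshift n i)).
rewrite -/sb /curve_euler mderiv0 !mulr0 addr0.
have -> : sb (\sum_(j < l) d j * h j) = \sum_(j < l) sb (d j * h j).
  exact: raddf_sum.
rewrite curve_subst_sum big1 ?mulr0 // => j _; have [u [v [uv ->]]] := hh j.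
have sbX (m : 'X_{1..n}) : curve_subst (sb 'X_[m]) =
    'X_(rshift n ord0) ^+ (\sum_(i < n) tnth A i * m i)%N.
  rewrite /sb mmapX rmorph_prod /= -prodrXr.
  by apply: eq_bigr => r _; rewrite rmorphXn /= curve_subst_xi exprM.
have -> : sb (d j * ('X_[u] - 'X_[v])) = sb (d j) * (sb 'X_[u] - sb 'X_[v]).
  by rewrite -raddfB -rmorphM.
by rewrite curve_substM curve_substB !sbX uv subrr mulr0.
Qed.

End MonomialCurve.

(** * Initial forms and the Euler form *)

(** A component of a weight that bounds all weights is the initial form as
    soon as it does not vanish. *)
Lemma initial_formE (k : nat) (K : nzRingType) (R : realDomainType)
    (w : 'I_k -> R) (d : R) (p : {mpoly K[k]}) :
  weight_le w d p -> wcomp w d p != 0 -> initial_form w p = wcomp w d p.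
Proof.
move=> hp top; rewrite /initial_form /wcomp big_seq_cond [RHS]big_seq_cond.
have [m0 pm0 m0d] : exists2 m0, m0 \in msupp p & mnm_weight w m0 = d.
  apply: contraPP top => h; apply/negP; rewrite negbK; apply/eqP/mpolyP => m.
  rewrite mcoeff_wcomp mcoeff0; case: eqP => // md.
  apply/eqP; rewrite mcoeff_eq0; apply/negP => pm; apply: h.
  by exists m.
apply: eq_bigl => m; apply: andb_id2l => pm; apply/allP/eqP => [h|-> m'].
  apply/eqP; rewrite eq_le -{2}m0d h // andbT; apply: hp.
  by rewrite -mcoeff_msupp.
by rewrite mcoeff_msupp => /hp.
Qed.

Section WeightedSubstitution.
Context (k l : nat) (K : comNzRingType) (R : realDomainType).
Context (w : 'I_k -> R) (v : 'I_l -> R) (g g' : 'I_k -> {mpoly K[l]}).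
Hypothesis g_le : forall i, weight_le v (w i) (g i).
Hypothesis g_top : forall i, wcomp v (w i) (g i) = g' i.

(** Top parts are multiplicative, and a monomial is a product of variables. *)
Lemma wcomp_mmap1 m : weight_le v (mnm_weight w m) (mmap1 g m) /\
  wcomp v (mnm_weight w m) (mmap1 g m) = mmap1 g' m.
Proof.
rewrite /mnm_weight /mmap1; elim: (index_enum _) => [|i s [le top]].
  rewrite !big_nil; split; first exact/homogeneous_ofW/homogeneous_of1.
  by rewrite (wcomp_homogeneous _ (@homogeneous_of1 _ _ _ v)) eqxx.
have ile := weight_le_exp (j := m i) (@g_le i).
rewrite !big_cons; split; first exact: weight_le_mul.
by rewrite wcomp_mul_top // top wcomp_exp_top // g_top.
Qed.

(** A term of [g i] lighter than the variable [i], and a term of [p] lighter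
    than [d], only contribute to components of weight less than [d]. *)
Lemma wcomp_mmap d p : weight_le w d p ->
  weight_le v d (mmap (@mpolyC l K) g p) /\
  wcomp v d (mmap (@mpolyC l K) g p) = mmap (@mpolyC l K) g' (wcomp w d p).
Proof.
move=> hp; split.
  rewrite /mmap; apply: weight_le_sum => m; rewrite mcoeff_msupp => /hp md.
  rewrite mul_mpolyC; apply/weight_leZ/(weight_leW md).
  by have [] := wcomp_mmap1 m.
rewrite [in RHS]/wcomp raddf_sum [RHS]raddf_sum /= big_seq_cond.
rewrite [RHS]big_mkcond [RHS]big_seq_cond; apply: eq_bigr => m.
rewrite andbT mcoeff_msupp => /hp md.
rewrite mul_mpolyC linearZ /=; have [le top] := wcomp_mmap1 m.
case: eqP => [e|ne]; first by rewrite -e top mmapZ mmapX mul_mpolyC.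
by rewrite (wcomp_lt le) ?scaler0 // lt_neqAle md andbT; apply/eqP.
Qed.

End WeightedSubstitution.

Section TopSymbol.
Context (n : nat) (K : idomainType) (R : realDomainType).
Context (A : n.-tuple nat) (beta : K) (w : 'I_(n + n) -> R) (tau s : R).
Hypothesis s_gt0 : 0 < s.
Hypothesis w_euler : forall i, w (lshift n i) + w (rshift n i) = s.
Hypothesis tau_le : forall i, tau *+ tnth A i <= w (rshift n i).

Definition curve_weight (k : 'I_(n + 1)) : R :=
  match split k with inl i => w (lshift n i) | inr _ => tau end.

(** [t ^ a_i] when it is as heavy as the variable [xi_i] that it replaces, and
    zero when it is lighter and so disappears from terms of top weight. *)
Definition top_curve_var (k : 'I_(n + n)) : {mpoly K[n + 1]} :=
  match split k with
  | inl i => 'X_(lshift 1 i)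
  | inr i => if tau *+ tnth A i == w (rshift n i)
             then 'X_(rshift n ord0) ^+ tnth A i else 0
  end.

Definition top_curve_subst : {mpoly K[n + n]} -> {mpoly K[n + 1]} :=
  mmap (@mpolyC _ K) top_curve_var.

HB.instance Definition _ := GRing.RMorphism.copy top_curve_subst top_curve_subst.

Definition euler_form : {mpoly K[n + n]} :=
  \sum_(i < n) ('X_(lshift n i) * 'X_(rshift n i)) *+ tnth A i.

Let W := curve_weight.
Let t : {mpoly K[n + 1]} := 'X_(rshift n ord0).

Lemma curve_weight_x i : W (lshift 1 i) = w (lshift n i).
Proof. by rewrite /W /curve_weight -[lshift 1 i]/(unsplit (inl i)) unsplitK. Qed.

Lemma curve_weight_t : W (rshift n ord0) = tau.
Proof. by rewrite /W /curve_weight -[rshift n _]/(unsplit (inr ord0)) unsplitK. Qed.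

Lemma homogeneous_of_tX j : homogeneous_of W (tau *+ j) (t ^+ j).
Proof.
apply: homogeneous_of_exp; rewrite -curve_weight_t -mnm_weight1.
exact: homogeneous_ofX.
Qed.

Lemma homogeneous_of_x i : 
  homogeneous_of W (w (lshift n i)) ('X_(lshift 1 i) : {mpoly K[n + 1]}).
Proof. by rewrite -curve_weight_x -mnm_weight1; apply: homogeneous_ofX. Qed.

Lemma wcomp_curve_subst d p : weight_le w d p ->
  weight_le W d (curve_subst A p) /\
  wcomp W d (curve_subst A p) = top_curve_subst (wcomp w d p).
Proof.
apply: wcomp_mmap => k; rewrite /top_curve_var; case: (split_ordP k) => i ->.
- exact/homogeneous_ofW/homogeneous_of_x.
- exact/(weight_leW (tau_le i))/homogeneous_ofW/homogeneous_of_tX.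
- by rewrite (wcomp_homogeneous _ (@homogeneous_of_x i)) eqxx.
- by rewrite (wcomp_homogeneous _ (@homogeneous_of_tX _)).
Qed.

Lemma curve_subst_euler_form : curve_subst A euler_form = curve_euler_symb K A.
Proof.
rewrite /euler_form curve_subst_sum; apply: eq_bigr => i _.
by rewrite curve_substMn curve_substM curve_subst_x curve_subst_xi.
Qed.

Lemma homogeneous_of_euler_form : homogeneous_of w s euler_form.
Proof.
apply: homogeneous_of_sum => i _ _; rewrite -scaler_nat.
apply/homogeneous_ofZ; rewrite -(w_euler i); apply: homogeneous_of_mul;
  rewrite -mnm_weight1; exact: homogeneous_ofX.
Qed.

(** [t d/dt] multiplies each monomial by a number. *)
Lemma weight_le_t_mderiv d q : weight_le W d q ->
  weight_le W d (t * q^`M(rshift n ord0)).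
Proof.
move=> hq; rewrite (mpolyE q) raddf_sum /= mulr_sumr; apply: weight_le_sum => m.
rewrite mcoeff_msupp => /hq md; rewrite mderivZ -scalerAr mulX_mderivX -scaler_nat.
by apply/weight_leZ/weight_leZ/(weight_leW md)/homogeneous_ofW/homogeneous_ofX.
Qed.

(** The operator [curve_euler] raises weights by [s], and its part of weight
    exactly [s] is the multiplication by the top part of the Euler form; in a
    domain, top parts multiply, so every top part of an element of its image
    is a multiple of that form. *)
Lemma initial_form_euler_multiple (P : weyl n K) :
  hypergeometric_ideal A beta P -> top_curve_subst euler_form != 0 ->
  exists r, top_curve_subst (initial_form w (symb P)) =
            top_curve_subst euler_form * r.
Proof.
move=> /hypergeometric_ideal_curve[q Pq] e0.
have [->|P0] := eqVneq (symb P) 0.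
  by exists 0; rewrite /initial_form msupp0 big_nil raddf0 mulr0.
(* Now compare the top weights of both sides of [Pq]. *)
have [d [Pd Ptop]] := top_weight w P0.
rewrite (initial_formE Pd Ptop).
have [Rle Rtop] := wcomp_curve_subst Pd.
have [q0|q0] := eqVneq q 0.
  exists 0; rewrite -Rtop Pq q0 /curve_euler mderiv0 !mulr0 addr0.
  exact: raddf0.
have [c [qc qtop]] := top_weight W q0.
have [Ele Etop] := wcomp_curve_subst (homogeneous_ofW homogeneous_of_euler_form).
rewrite curve_subst_euler_form in Ele Etop.
rewrite (wcomp_homogeneous _ homogeneous_of_euler_form) eqxx in Etop.
have cs : c < s + c by rewrite ltrDr.
have Qle : weight_le W c (t * q^`M(rshift n ord0) - beta%:MP * q).
  apply: weight_leD; first exact: weight_le_t_mderiv.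
  by rewrite mul_mpolyC -scaleNr; apply: weight_leZ.
have Qtop : wcomp W (s + c) (curve_euler A beta q) =
    top_curve_subst euler_form * wcomp W c q.
  rewrite /curve_euler mulrBl addrCA raddfD /= wcomp_mul_top //.
  by rewrite (wcomp_lt Qle) // addr0 Etop.
have Qtop0 : wcomp W (s + c) (curve_euler A beta q) != 0.
  by rewrite Qtop mulf_neq0.
have : s + c <= d.
  rewrite leNgt; apply: contra Qtop0 => dc; rewrite -Pq.
  by rewrite (wcomp_lt Rle).
(* If the symbol becomes lighter under the substitution, its reduced top part
   is zero; otherwise the two top weights agree. *)
rewrite le_eqVlt => /orP[/eqP dE|dlt].
  by exists (wcomp W c q); rewrite -Rtop Pq -dE Qtop.
exists 0; rewrite -Rtop Pq mulr0 /curve_euler mulrBl addrCA.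
apply: (@wcomp_lt _ _ _ _ (s + c)) => //; apply: weight_leD.
  exact: weight_le_mul.
exact: weight_leW (ltW cs) Qle.
Qed.

End TopSymbol.

(** * Germs of initial ideals at the origin *)

(** Substituting homogeneous polynomials of the weights of the variables, and
    constants of weight zero for the coefficients, preserves weights. *)
Lemma mmap_homogeneous (k l : nat) (K S : comNzRingType) (V : realDomainType)
    (f : {rmorphism K -> {mpoly S[l]}}) (h : 'I_k -> {mpoly S[l]})
    (u : 'I_k -> V) (v : 'I_l -> V) d p :
  (forall c, homogeneous_of v 0 (f c)) ->
  (forall i, homogeneous_of v (u i) (h i)) ->
  homogeneous_of u d p -> homogeneous_of v d (mmap f h p).
Proof.
move=> hf hh hp; apply: homogeneous_of_sum => m; rewrite mcoeff_msupp => pm _.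
rewrite -(hp m pm) -[X in homogeneous_of _ X]add0r; apply: homogeneous_of_mul => //.
rewrite /mnm_weight /mmap1; elim: (index_enum _) => [|i s ih].
  by rewrite !big_nil; apply: homogeneous_of1.
by rewrite !big_cons; apply: homogeneous_of_mul => //; apply: homogeneous_of_exp.
Qed.

Section Germs.
Context (n : nat) (K : numFieldType).

(** Coefficients and variables of [to_gr_germ] are named separately, so that the
    ring morphism structure of this substitution can be inferred. *)
Definition gr_const (c : K) : {mpoly (cps n K)[1 + n.+1]} :=
  (cps_of_mpoly c%:MP)%:MP.

HB.instance Definition _ := GRing.RMorphism.copy gr_const
  (@mpolyC (1 + n.+1) (cps n K) \o @cps_of_mpoly n K \o @mpolyC n K).

Definition gr_var (k : 'I_(n.+1 + n.+1)) : {mpoly (cps n K)[1 + n.+1]} :=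
  match split k with
  | inl i => if unlift ord_max i is Some j
             then (cps_of_mpoly 'X_j)%:MP
             else 'X_(lshift n.+1 ord0)
  | inr i => 'X_(rshift 1 i)
  end.

HB.instance Definition _ := GRing.RMorphism.copy (@to_gr_germ n K)
  (mmap gr_const gr_var).

Lemma to_gr_germM : {morph @to_gr_germ n K : p q / p * q}.
Proof. exact: (rmorphM (@to_gr_germ n K)). Qed.

Lemma to_gr_germB : {morph @to_gr_germ n K : p q / p - q}.
Proof. exact: (rmorphB (@to_gr_germ n K)). Qed.

Lemma to_gr_germ_sum (T : Type) (s : seq T) (Q : pred T)
    (F : T -> {mpoly K[n.+1 + n.+1]}) :
  @to_gr_germ n K (\sum_(i <- s | Q i) F i) = \sum_(i <- s | Q i) to_gr_germ (F i).
Proof. exact: (raddf_sum (@to_gr_germ n K)). Qed.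

Lemma gr_var_xi i : gr_var (rshift n.+1 i) = 'X_(rshift 1 i).
Proof. by rewrite /gr_var -[rshift _ i]/(unsplit (inr i)) unsplitK. Qed.

Lemma to_gr_germX m : to_gr_germ 'X_[m] = mmap1 gr_var m.
Proof. exact: (mmapX gr_var gr_const). Qed.

Lemma to_gr_germ_xi i : @to_gr_germ n K 'X_(rshift n.+1 i) = 'X_(rshift 1 i).
Proof. by rewrite to_gr_germX mmap1U gr_var_xi. Qed.

Lemma mpolyC_homogeneous (l : nat) (S : nzRingType) (V : realDomainType)
  (v : 'I_l -> V) (c : S) : homogeneous_of v 0 c%:MP.
Proof.
move=> m; rewrite mcoeffC; case: (eqVneq m 0%MM) => [->|]; rewrite ?mnm_weight0 //.
by rewrite mulr0 eqxx.
Qed.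

(** The change of rings respects both gradings, as the coordinates that become
    power series have weight zero. *)
Lemma gr_var_F k : homogeneous_of (@gr_F n) (weyl_F k) (gr_var k).
Proof.
rewrite /weyl_F /gr_var; case: split_ordP => i _.
  case: unliftP => [j _|_]; first exact: mpolyC_homogeneous.
  have -> : 0 = @gr_F n (lshift n.+1 ord0).
    by rewrite /gr_F -[lshift _ _]/(unsplit (inl ord0)) unsplitK.
  by rewrite -mnm_weight1; apply: homogeneous_ofX.
have -> : 1 = @gr_F n (rshift 1 i).
  by rewrite /gr_F -[rshift _ _]/(unsplit (inr i)) unsplitK.
by rewrite -mnm_weight1; apply: homogeneous_ofX.
Qed.

Lemma gr_var_V k : homogeneous_of (@gr_V n) (weyl_V k) (gr_var k).
Proof.
rewrite /weyl_V /gr_var; case: split_ordP => i _.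
  case: unliftP => [j ->|->].
    by rewrite eq_sym (negbTE (neq_lift _ _)); apply: mpolyC_homogeneous.
  rewrite eqxx; have -> : -1 = @gr_V n (lshift n.+1 ord0).
    by rewrite /gr_V -[lshift _ _]/(unsplit (inl ord0)) unsplitK.
  by rewrite -mnm_weight1; apply: homogeneous_ofX.
have -> : (if i == ord_max then 1 else 0) = @gr_V n (rshift 1 i).
  by rewrite /gr_V -[rshift _ _]/(unsplit (inr i)) unsplitK.
by rewrite -mnm_weight1; apply: homogeneous_ofX.
Qed.

Section Radical.
Context (R : realFieldType) (w : 'I_(n.+1 + n.+1) -> R) (I : set (weyl n.+1 K)).
Let J := radical (sigma_ideal w I).

Lemma left_ideal_radical_sigma : left_ideal J.
Proof. exact/left_ideal_radical/left_ideal_left_ideal_gen. Qed.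

Lemma initial_form_sigma P : I P -> P != 0 -> J (to_gr_germ (initial_form w (symb P))).
Proof.
move=> IP P0; apply/sub_radical/sub_left_ideal_gen.
exists (initial_form w (symb P)) => //.
by apply: sub_left_ideal_gen; exists P.
Qed.

Lemma radical_sigma_exp q j : J (to_gr_germ (q ^+ j)) -> J (to_gr_germ q).
Proof. by case=> i; rewrite rmorphXn -exprM => h; exists (j * i)%N. Qed.

Lemma radical_sigma_mnm m m' : (m' <= m)%MM ->
  J (to_gr_germ 'X_[m']) -> J (to_gr_germ 'X_[m]).
Proof.
move=> le Jm'; rewrite -(submK le) mpolyXD rmorphM.
by case: left_ideal_radical_sigma => _ _; apply.
Qed.

(** When the monomials of each initial form that are not already in the
    radical have a common degree for a grading, the initial form splits, modulo
    monomials of the radical, into a single homogeneous piece. *)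
Lemma radical_sigma_homogeneous (u : 'I_(n.+1 + n.+1) -> int)
    (v : 'I_(1 + n.+1) -> int) :
  (forall k, homogeneous_of v (u k) (gr_var k)) ->
  (forall P m m', I P -> P != 0 ->
     m \in msupp (initial_form w (symb P)) ->
     m' \in msupp (initial_form w (symb P)) ->
     ~ J (to_gr_germ 'X_[m]) -> ~ J (to_gr_germ 'X_[m']) ->
     mnm_weight u m = mnm_weight u m') ->
  homogeneous_ideal v J.
Proof.
move=> uv hI; have JI := left_ideal_radical_sigma; have [J0 JD JM] := JI.
have homJ d p q : homogeneous_of v d q -> J q -> J (wcomp v p q).
  by move=> hq Jq; rewrite (wcomp_homogeneous _ hq); case: ifP => _; [exact: Jq|exact: J0].
have homg d (p : {mpoly K[n.+1 + n.+1]}) :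
    homogeneous_of u d p -> homogeneous_of v d (to_gr_germ p).
  move=> hp; rewrite -[to_gr_germ p]/(mmap gr_const gr_var p).
  by apply: (mmap_homogeneous (u := u)) hp => // c; apply: mpolyC_homogeneous.
have [_ CD CM] := left_ideal_homogeneous_core v JI.
apply: homogeneous_radical => _ d [q + <-]; rewrite -/J => qI.
move: d; apply: (left_ideal_gen_sub (J := [set q | forall d, J (wcomp v d (to_gr_germ q))])) qI.
  split=> [d|p1 p2 h1 h2 d|c p h d] /=; first by rewrite !raddf0; exact: J0.
  - rewrite rmorphD; exact: (CD _ _ h1 h2).
  - rewrite rmorphM; exact: (CM _ _ h).
move=> _ [P [IP P0] <-] d /=; set p := initial_form _ _.
have pE : p = \sum_(m <- msupp p | `[< J (to_gr_germ 'X_[m]) >]) p@_m *: 'X_[m] +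
              \sum_(m <- msupp p | ~~ `[< J (to_gr_germ 'X_[m]) >]) p@_m *: 'X_[m].
  by rewrite {1}(mpolyE p) (bigID (fun m => `[< J (to_gr_germ 'X_[m]) >])).
set p1 := (X in _ = X + _) in pE; set p2 := (X in _ = _ + X) in pE.
have term d' c m : J (to_gr_germ 'X_[m]) -> J (wcomp v d' (to_gr_germ (c *: 'X_[m]))).
  move=> Jm; apply: (homJ (mnm_weight u m)).
    exact/homg/homogeneous_ofZ/homogeneous_ofX.
  rewrite -mul_mpolyC rmorphM; exact: JM.
have J1 d' : J (wcomp v d' (to_gr_germ p1)).
  rewrite /p1 to_gr_germ_sum wcomp_sum; apply: (left_ideal_sum JI) => m _ /asboolP.
  exact: term.
have Jp1 : J (to_gr_germ p1).
  rewrite /p1 to_gr_germ_sum; apply: (left_ideal_sum JI) => m _ /asboolP.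
  rewrite -mul_mpolyC rmorphM; exact: JM.
have Jp2 : J (to_gr_germ p2).
  have -> : to_gr_germ p2 = to_gr_germ p - to_gr_germ p1.
    by rewrite [X in _ = to_gr_germ X - _]pE rmorphD addrC addKr.
  by apply: (left_idealB JI _ Jp1); apply: initial_form_sigma.
rewrite pE rmorphD raddfD; apply: (JD _ _ (J1 d)).
have [/hasP[m0 pm0 /asboolP Jm0]|/hasPn none] :=
    boolP (has (fun m => `[< ~ J (to_gr_germ 'X_[m]) >]) (msupp p)).
  apply: (homJ (mnm_weight u m0) _ _ _ Jp2); apply/homg/homogeneous_of_sum => m pm.
  move=> /asboolPn Jm; apply/homogeneous_ofZ.
  by rewrite (hI P m0 m IP P0 pm0 pm Jm0 Jm); apply: homogeneous_ofX.
suff -> : p2 = 0 by rewrite !raddf0; exact: J0.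
rewrite /p2 big_seq_cond big1 // => m /andP[/none /asboolPn h].
by move=> /asboolPn /h.
Qed.

End Radical.

Definition cps_coef0 (f : cps n K) : K := fcoef (val f) 0%MM.

Lemma cps_coef0_mpoly p : cps_coef0 (cps_of_mpoly p) = p@_0%MM.
Proof. by []. Qed.

Fact cps_coef0_is_additive : additive cps_coef0.
Proof. by move=> f g. Qed.
HB.instance Definition _ := GRing.isAdditive.Build (cps n K) K
  cps_coef0 cps_coef0_is_additive.

Fact cps_coef0_is_multiplicative : multiplicative cps_coef0.
Proof.
split=> [f g|]; last by rewrite /cps_coef0 /= mcoeff1 eqxx.
rewrite /cps_coef0 -[fcoef (val (f * g)) _]/(fcoef (fps_mul (val f) (val g)) _).
by rewrite (@fcoef_mulE _ _ 1) ?mdeg0 // rmorphM /= !mcoeff_trunc ?mdeg0.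
Qed.
HB.instance Definition _ := GRing.isMultiplicative.Build (cps n K) K
  cps_coef0 cps_coef0_is_multiplicative.

(** Evaluation of a germ at the point with all [x_i = 0] and [xi = z]; this
    point lies on the fibre over the origin, so it makes sense for power
    series coefficients. *)
Definition germ_eval (z : 'I_n.+1 -> K) : {mpoly (cps n K)[1 + n.+1]} -> K :=
  mmap cps_coef0 (fun k => match split k with inl _ => 0 | inr i => z i end).

HB.instance Definition _ z := GRing.RMorphism.copy (germ_eval z) (germ_eval z).

Lemma germ_evalC z c : germ_eval z c%:MP = cps_coef0 c.
Proof. exact: mmapC. Qed.

Lemma germ_evalX z k :
  germ_eval z 'X_k = match split k with inl _ => 0 | inr i => z i end.
Proof. by rewrite /germ_eval mmapX mmap1U. Qed.

Lemma germ_evalM z : {morph germ_eval z : p q / p * q}.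
Proof. exact: (rmorphM (germ_eval z)). Qed.

Lemma germ_eval_sum z (T : Type) (s : seq T) (F : T -> {mpoly (cps n K)[1 + n.+1]}) :
  germ_eval z (\sum_(i <- s) F i) = \sum_(i <- s) germ_eval z (F i).
Proof. exact: (raddf_sum (germ_eval z)). Qed.

Definition conormal_point (z : 'I_n.+1 -> K) (k : 'I_(n.+1 + n.+1)) : K :=
  match split k with inl _ => 0 | inr i => z i end.

Lemma germ_eval_to_gr z q : germ_eval z (to_gr_germ q) = q.@[conormal_point z].
Proof.
rewrite {1}(mpolyE q) to_gr_germ_sum germ_eval_sum mevalE.
apply: eq_bigr => m _; rewrite -mul_mpolyC to_gr_germM germ_evalM.
congr (_ * _).
  rewrite [to_gr_germ _](mmapC gr_var gr_const) germ_evalC cps_coef0_mpoly.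
  by rewrite mcoeffC eqxx mulr1.
rewrite to_gr_germX rmorph_prod /=; apply: eq_bigr => k _.
rewrite rmorphXn /=; congr (_ ^+ _); rewrite /gr_var /conormal_point.
case: split_ordP => i _.
  case: unliftP => [j _|_].
    by rewrite germ_evalC cps_coef0_mpoly mcoeffX mnm1_eq0.
  rewrite germ_evalX.
  by rewrite -[lshift _ _]/(unsplit (inl ord0)) unsplitK.
rewrite germ_evalX.
by rewrite -[rshift _ _]/(unsplit (inr i)) unsplitK.
Qed.

(** A point of the characteristic variety bounds the radical from above:
    evaluation there is a ring morphism to a field that kills the ideal, hence
    also its radical. *)
Lemma germ_eval_sigma (R : realFieldType) (w : 'I_(n.+1 + n.+1) -> R)
    (I : set (weyl n.+1 K)) z q :
  (forall P, I P -> (initial_form w (symb P)).@[conormal_point z] = 0) ->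
  radical (sigma_ideal w I) q -> germ_eval z q = 0.
Proof.
move=> h [k qk]; suff : germ_eval z (q ^+ k) = 0.
  by rewrite rmorphXn => /eqP; rewrite expf_eq0 => /andP[_ /eqP].
apply: (left_ideal_gen_sub (J := [set q | germ_eval z q = 0])) qk.
  split=> [|p1 p2 /= h1 h2|c p /= hp] /=; first exact: raddf0.
    by rewrite rmorphD /= h1 h2 addr0.
  by rewrite germ_evalM hp mulr0.
move=> _ [p pI <-] /=; rewrite germ_eval_to_gr.
apply: (left_ideal_gen_sub (J := [set p | p.@[conormal_point z] = 0])) pI.
  split=> [|p1 p2 /= h1 h2|c p' /= hp] /=; first exact: raddf0.
    by rewrite rmorphD /= h1 h2 addr0.
  by rewrite rmorphM /= hp mulr0.
by move=> _ [P [IP _] <-] /=; apply: h.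
Qed.

End Germs.

(** * Binomials and the Euler operator *)

Section Weights.
Context (n : nat) (R : realFieldType).

Lemma weyl_L_x (s : R) (i : 'I_n.+1) :
  weyl_L s 1 (lshift n.+1 i) = if i == ord_max then -1 else 0.
Proof.
rewrite /weyl_L /weyl_F /weyl_V -[lshift _ i]/(unsplit (inl i)) unsplitK.
by case: ifP => _; rewrite mulr0 add0r ?mulr0 // mul1r mulrN1z.
Qed.

Lemma weyl_L_xi (s : R) (i : 'I_n.+1) :
  weyl_L s 1 (rshift n.+1 i) = s + (i == ord_max)%:R.
Proof.
rewrite /weyl_L /weyl_F /weyl_V -[rshift _ i]/(unsplit (inr i)) unsplitK.
by case: ifP => _; rewrite mulr1 ?mulr0 ?mulr1.
Qed.

Lemma mnm_weight_L (p q : R) (m : 'X_{1..n.+1 + n.+1}) :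
  mnm_weight (weyl_L p q) m =
  p * (mnm_weight (@weyl_F n) m)%:~R + q * (mnm_weight (@weyl_V n) m)%:~R.
Proof.
rewrite /mnm_weight !raddf_sum !mulr_sumr -big_split; apply: eq_bigr => k _ /=.
by rewrite /weyl_L mulrnDl !rmorphMn !mulrnAr.
Qed.

End Weights.

Lemma homogeneous_ofU (k : nat) (K : nzRingType) (V : realDomainType)
    (w : 'I_k -> V) (i : 'I_k) : homogeneous_of w (w i) ('X_i : {mpoly K[k]}).
Proof. by rewrite -mnm_weight1; apply: homogeneous_ofX. Qed.

(** All terms of an initial form have the same, maximal, weight. *)
Lemma homogeneous_initial_form (k : nat) (K : nzRingType) (V : realDomainType)
    (w : 'I_k -> V) (p : {mpoly K[k]}) :
  exists d, homogeneous_of w d (initial_form w p).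
Proof.
have [->|p0] := eqVneq p 0.
  by exists 0; rewrite /initial_form msupp0 big_nil => m; rewrite mcoeff0 eqxx.
have [d [le top]] := top_weight w p0; exists d.
by rewrite (initial_formE le top); apply: homogeneous_of_wcomp.
Qed.

Section Operators.
Context (n : nat) (K : numFieldType) (A : n.-tuple nat) (beta : K).

Lemma binomial_hypergeometric i j k l : (tnth A i * k = tnth A j * l)%N ->
  exists P, hypergeometric_ideal A beta P /\
    symb P = 'X_(rshift n i) ^+ k - 'X_(rshift n j) ^+ l.
Proof.
move=> kl; pose f : {mpoly K[n]} := 'X_[U_(i) *+ k] - 'X_[U_(j) *+ l].
have sumU r c : (\sum_(h < n) tnth A h * (U_(r) *+ c)%MM h)%N = (tnth A r * c)%N.
  rewrite (bigD1 r) //= mulmnE mnm1E eqxx mul1n big1 ?addn0 // => h hr.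
  by rewrite mulmnE mnm1E eq_sym (negbTE hr) mul0n muln0.
exists (mmap weylC weyld f); split.
  apply: sub_left_ideal_gen; left; exists f => //.
  by apply: sub_left_ideal_gen; exists (U_(i) *+ k)%MM, (U_(j) *+ l)%MM; rewrite !sumU.
rewrite -[mmap weylC _ _]mul1r symb_mul_const_coeff -[symb 1]/(1 : {mpoly K[n + n]}).
by rewrite mul1r /f raddfB /= -!mpolyXn !rmorphXn /= !mmapX !mmap1U.
Qed.

Lemma symb_euler_op : symb (euler_op A beta) = euler_form K A - beta%:MP.
Proof.
rewrite /euler_op symbB symb_sum; congr (_ - _); apply: eq_bigr => i _.
by rewrite mulr_natl symbMn symb_weylx.
Qed.

(** The value at the point with all coordinates 1 is the sum of the entries of
    [A], which is nonzero in characteristic zero. *)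
Lemma euler_form_neq0 : (0 < \sum_(i < n) tnth A i)%N -> euler_form K A != 0.
Proof.
move=> A0; apply/eqP => /(congr1 (meval (fun=> 1))).
rewrite /euler_form raddf_sum meval0 /=.
under eq_bigr do rewrite mevalMn mevalM !mevalXU mulr1.
by move=> /eqP; rewrite -natr_sum pnatr_eq0 -leqn0 leqNgt A0.
Qed.

End Operators.

Section Radicals.
Context (n : nat) (K : numFieldType) (R : realFieldType).
Context (A : n.+1.-tuple nat) (beta : K) (s : R).
Hypothesis s_gt0 : 0 < s.
Let w : 'I_(n.+1 + n.+1) -> R := weyl_L s 1.
Let I := hypergeometric_ideal A beta.
Let J := radical (sigma_ideal w I).

Lemma weyl_L_euler i : w (lshift n.+1 i) + w (rshift n.+1 i) = s.
Proof. by rewrite /w weyl_L_x weyl_L_xi; case: ifP => _ /=; ring. Qed.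

(** The heavier of the two powers is the initial form of the toric binomial,
    and the radical contains the roots of its elements. *)
Lemma binomial_radical i j k l : (tnth A i * k = tnth A j * l)%N ->
  w (rshift n.+1 j) *+ l < w (rshift n.+1 i) *+ k ->
  J (to_gr_germ 'X_(rshift n.+1 i)).
Proof.
move=> kl lt; have [P [IP symbP]] := binomial_hypergeometric beta kl.
have hi := homogeneous_of_exp (j := k) (@homogeneous_ofU _ K _ w (rshift n.+1 i)).
have hj := homogeneous_of_exp (j := l) (@homogeneous_ofU _ K _ w (rshift n.+1 j)).
have top : wcomp w (w (rshift n.+1 i) *+ k) (symb P) = 'X_(rshift n.+1 i) ^+ k.
  rewrite symbP raddfB /= (wcomp_homogeneous _ hi) eqxx (wcomp_homogeneous _ hj).
  by rewrite (lt_eqF lt) subr0.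
have top0 : wcomp w (w (rshift n.+1 i) *+ k) (symb P) != 0.
  by rewrite top expf_neq0 // -msupp_eq0 msuppX.
have le : weight_le w (w (rshift n.+1 i) *+ k) (symb P).
  rewrite symbP -scaleN1r; apply: weight_leD; first exact: homogeneous_ofW.
  by apply/weight_leZ/(weight_leW (ltW lt))/homogeneous_ofW.
apply: (@radical_sigma_exp _ _ _ _ _ _ k).
rewrite -top -(initial_formE le top0); apply: initial_form_sigma => //.
by apply: contraNneq top0 => ->; rewrite raddf0.
Qed.

(** Each [x_i xi_i] has [L]-weight [s > 0], also for the last index, where the
    weights of [x_i] and [xi_i] contain [-1] and [1]; hence the Euler form is
    the initial form of the Euler operator. *)
Lemma euler_form_radical : (0 < \sum_(i < n.+1) tnth A i)%N ->
  J (to_gr_germ (euler_form K A)).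
Proof.
move=> A0; have hE : homogeneous_of w s (euler_form K A).
  exact: homogeneous_of_euler_form weyl_L_euler.
have top : wcomp w s (symb (euler_op A beta)) = euler_form K A.
  rewrite symb_euler_op raddfB /= (wcomp_homogeneous _ hE) eqxx.
  rewrite (wcomp_homogeneous _ (@mpolyC_homogeneous _ _ _ w beta)).
  by rewrite (lt_eqF s_gt0) subr0.
have top0 : wcomp w s (symb (euler_op A beta)) != 0.
  by rewrite top euler_form_neq0.
have le : weight_le w s (symb (euler_op A beta)).
  rewrite symb_euler_op -scaleN1r; apply: weight_leD; first exact: homogeneous_ofW.
  apply/weight_leZ/(weight_leW (ltW s_gt0))/homogeneous_ofW.
  exact: mpolyC_homogeneous.
rewrite -top -(initial_formE le top0); apply: initial_form_sigma.
  by apply: sub_left_ideal_gen; right.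
by apply: contraNneq top0 => ->; rewrite raddf0.
Qed.

(** Once the other [xi_i] are in the radical, only the summand [a_j x_j xi_j]
    of the Euler form is left. Together they cut out the union of the zero section
    and the conormal space of [x_j = 0]. *)
Lemma conormal_radical j : (0 < tnth A j)%N ->
  (forall i, i != j -> J (to_gr_germ 'X_(rshift n.+1 i))) ->
  J (to_gr_germ ('X_(lshift n.+1 j) * 'X_(rshift n.+1 j))).
Proof.
move=> Aj hi; have JI : left_ideal J by apply: left_ideal_radical_sigma.
have [J0 JD JM] := JI.
have A0 : (0 < \sum_(i < n.+1) tnth A i)%N by rewrite (bigD1 j) //= addn_gt0 Aj.
have -> : 'X_(lshift n.+1 j) * 'X_(rshift n.+1 j) =
    ((tnth A j)%:R^-1 : K)%:MP * (euler_form K A -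
      \sum_(i < n.+1 | i != j) ('X_(rshift n.+1 i) * 'X_(lshift n.+1 i)) *+ tnth A i).
  rewrite /euler_form (bigD1 j) //=; under [X in _ - X]eq_bigr do rewrite mulrC.
  by rewrite addrK mul_mpolyC -scaler_nat scalerA mulVf ?scale1r // pnatr_eq0 -lt0n.
rewrite to_gr_germM; apply: (JM); rewrite to_gr_germB.
apply: (left_idealB JI); first exact: euler_form_radical.
rewrite to_gr_germ_sum; apply: (left_ideal_sum JI) => i _ ij.
rewrite -mulrnAr mulrC to_gr_germM; exact/JM/hi.
Qed.

(** The radical contains all multiples of a monomial that it contains. *)
Lemma notin_radical_xi i m : J (to_gr_germ 'X_(rshift n.+1 i)) ->
  ~ J (to_gr_germ 'X_[m]) -> m (rshift n.+1 i) = 0%N.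
Proof.
move=> Ji; apply: contra_notP => /eqP mi; apply: radical_sigma_mnm Ji.
by rewrite lep1mP.
Qed.

Lemma notin_radical_conormal i m :
  J (to_gr_germ ('X_(lshift n.+1 i) * 'X_(rshift n.+1 i))) ->
  ~ J (to_gr_germ 'X_[m]) -> m (lshift n.+1 i) = 0%N \/ m (rshift n.+1 i) = 0%N.
Proof.
rewrite -mpolyXD => Ji; apply: contra_notP => /not_orP[/eqP mi /eqP mi'].
apply: radical_sigma_mnm Ji; apply/mnm_lepP => k; rewrite mnmDE !mnm1E.
have [<-|ki] := eqVneq (lshift n.+1 i) k; first by rewrite eq_rlshift addn0 lt0n.
by have [<-|//] := eqVneq (rshift n.+1 i) k; rewrite add0n lt0n.
Qed.

End Radicals.

(** * The case of three variables *)

Lemma mcoeff_XM0 (k : nat) (K : comNzRingType) (i : 'I_k) (q : {mpoly K[k]})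
    (m : 'X_{1..k}) :
  m i = 0%N -> ('X_i * q)@_m = 0.
Proof.
move=> mi; rewrite mcoeffM big1 // => -[k1 k2] /= /eqP mk.
rewrite mcoeffX; case: eqP => [e|]; last by rewrite mul0r.
by move: (congr1 (fun u : 'X_{1..k} => u i) mk); rewrite mi mnmDE -e mnm1E eqxx.
Qed.

Section ThreeVariables.
Context (K : numFieldType) (R : realFieldType) (a b : nat) (beta : K) (s : R).
Hypothesis a_gt1 : (1 < a)%N.
Hypothesis ab : (a < b)%N.
Hypothesis s_gt0 : 0 < s.

Let A := [tuple 1%N; a; b].
Let i2 : 'I_3 := Ordinal (isT : (1 < 3)%N).
Let i3 : 'I_3 := ord_max.
Let w : 'I_(3 + 3) -> R := weyl_L s 1.
Let I := hypergeometric_ideal A beta.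
Let J := radical (sigma_ideal w I).

Lemma ord3P (i : 'I_3) : [\/ i = ord0, i = i2 | i = i3].
Proof.
by case: i => -[|[|[|//]]] h; [constructor 1|constructor 2|constructor 3]; apply: val_inj.
Qed.

Lemma big_ord3 (T : Type) (idx : T) (op : Monoid.law idx) (F : 'I_3 -> T) :
  \big[op/idx]_(i < 3) F i = op (F ord0) (op (F i2) (F i3)).
Proof.
rewrite !big_ord_recl big_ord0 Monoid.mulm1.
by congr (op _ (op (F _) (F _))); apply: val_inj.
Qed.

Lemma tnthA : (tnth A ord0 = 1%N) * (tnth A i2 = a) * (tnth A i3 = b).
Proof. by []. Qed.

Lemma weight_xi1 : w (rshift 3 ord0) = s.
Proof. by rewrite /w weyl_L_xi addr0. Qed.

Lemma weight_xi2 : w (rshift 3 i2) = s.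
Proof. by rewrite /w weyl_L_xi addr0. Qed.

Lemma weight_xi3 : w (rshift 3 i3) = s + 1.
Proof. by rewrite /w weyl_L_xi eqxx. Qed.

Lemma mnm_weight_F (m : 'X_{1..3 + 3}) : mnm_weight (@weyl_F 2) m =
  (m (rshift 3 ord0) + m (rshift 3 i2) + m (rshift 3 i3))%N%:Z.
Proof.
rewrite /mnm_weight big_split_ord /= big1 => [|i _]; last first.
  by rewrite /weyl_F -[lshift _ i]/(unsplit (inl i)) unsplitK mul0rn.
rewrite add0r (eq_bigr (fun i => (m (rshift 3 i))%:Z)) => [|i _]; last first.
  by rewrite /weyl_F -[rshift _ i]/(unsplit (inr i)) unsplitK natz.
by rewrite big_ord3 /= !PoszD addrA.
Qed.

Lemma mnm_weight_V (m : 'X_{1..3 + 3}) : mnm_weight (@weyl_V 2) m =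
  (m (rshift 3 i3))%:Z - (m (lshift 3 i3))%:Z.
Proof.
rewrite /mnm_weight big_split_ord !big_ord3 /weyl_V.
rewrite -![lshift _ _]/(unsplit (inl _)) -![rshift _ _]/(unsplit (inr _)) !unsplitK /=.
by rewrite !mul0rn !add0r addrC mulNrn !natz.
Qed.

Lemma initial_form_weight (P : weyl 3 K) m m' :
  m \in msupp (initial_form w (symb P)) -> m' \in msupp (initial_form w (symb P)) ->
  mnm_weight w m = mnm_weight w m'.
Proof.
have [d hd] := homogeneous_initial_form w (symb P).
by rewrite !mcoeff_msupp => /hd -> /hd ->.
Qed.

Lemma xi1_radical : J (to_gr_germ 'X_(rshift 3 ord0)).
Proof.
apply: (@binomial_radical _ _ _ A beta s ord0 i2 a 1).
  by rewrite !tnthA mul1n muln1.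
rewrite -/w weight_xi1 weight_xi2 mulr1n -mulr_natr.
by rewrite ltr_pMr // ltr1n.
Qed.

Lemma xi2_radical : a%:R < s * (b%:R - a%:R) -> J (to_gr_germ 'X_(rshift 3 i2)).
Proof.
move=> hs; apply: (@binomial_radical _ _ _ A beta s i2 i3 b a).
  by rewrite !tnthA mulnC.
by rewrite -/w weight_xi2 weight_xi3 -[(s + 1) *+ _]mulr_natr -[s *+ _]mulr_natr; lra.
Qed.

Lemma xi3_radical : s * (b%:R - a%:R) < a%:R -> J (to_gr_germ 'X_(rshift 3 i3)).
Proof.
move=> hs; apply: (@binomial_radical _ _ _ A beta s i3 i2 a b).
  by rewrite !tnthA mulnC.
by rewrite -/w weight_xi2 weight_xi3 -[(s + 1) *+ _]mulr_natr -[s *+ _]mulr_natr; lra.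
Qed.

Lemma x3xi3_radical : a%:R < s * (b%:R - a%:R) ->
  J (to_gr_germ ('X_(lshift 3 i3) * 'X_(rshift 3 i3))).
Proof.
move=> hs; apply: (conormal_radical s_gt0); first by rewrite tnthA; lia.
move=> i; have [->|->|->] := ord3P i => // _; first exact: xi1_radical.
exact: xi2_radical.
Qed.

Lemma x2xi2_radical : s * (b%:R - a%:R) < a%:R ->
  J (to_gr_germ ('X_(lshift 3 i2) * 'X_(rshift 3 i2))).
Proof.
move=> hs; apply: (conormal_radical s_gt0); first by rewrite tnthA; lia.
move=> i; have [->|->|->] := ord3P i => // _; first exact: xi1_radical.
exact: xi3_radical.
Qed.

(** [k] and [x] stand for the exponents of [xi_3] and [x_3]: the number
    [(s + 1) k - x] is positive, negative or zero according to which of the two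
    is nonzero, so it determines both. *)
Lemma conormal_weights (x k x' k' : nat) : x = 0%N \/ k = 0%N ->
  x' = 0%N \/ k' = 0%N ->
  s * k%:R + (k%:R - x%:R) = s * k'%:R + (k'%:R - x'%:R) -> k = k' /\ x = x'.
Proof.
have s0 := s_gt0; have s1 : s + 1 != 0 by apply: lt0r_neq0; lra.
have pos (j : nat) : 0 <= j%:R :> R by exact: ler0n.
have eq0 (y z : nat) : (s + 1) * y%:R + z%:R = 0 -> y = 0%N /\ z = 0%N.
  move=> e; have y0 : 0 <= (s + 1) * y%:R by rewrite mulr_ge0 //; lra.
  have [ey ez] : (s + 1) * y%:R = 0 /\ z%:R = 0 :> R.
    by have := pos z; split; lra.
  move: ey ez => /eqP; rewrite mulf_eq0 (negbTE s1) /= pnatr_eq0 => /eqP ->.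
  by move=> /eqP; rewrite pnatr_eq0 => /eqP.
move=> [->|->] [->|->] e.
- by split=> //; apply/eqP; rewrite -(eqr_nat R); apply/eqP/(mulfI s1); lra.
- by have [-> ->] : k = 0%N /\ x' = 0%N by apply: eq0; lra.
- by have [-> ->] : k' = 0%N /\ x = 0%N by apply: eq0; lra.
- by split=> //; apply/eqP; rewrite -(eqr_nat R); apply/eqP; lra.
Qed.

Lemma bihomogeneous_radical :
  (forall P m m', I P ->
     m \in msupp (initial_form w (symb P)) ->
     m' \in msupp (initial_form w (symb P)) ->
     ~ J (to_gr_germ 'X_[m]) -> ~ J (to_gr_germ 'X_[m']) ->
     mnm_weight (@weyl_F 2) m = mnm_weight (@weyl_F 2) m' /\
     mnm_weight (@weyl_V 2) m = mnm_weight (@weyl_V 2) m') ->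
  homogeneous_ideal (@gr_F 2) J /\ homogeneous_ideal (@gr_V 2) J.
Proof.
move=> h; split.
- apply: (radical_sigma_homogeneous (@gr_var_F 2 K)) => P m m' IP _ pm pm' Jm Jm'.
  by have [] := h P m m' IP pm pm' Jm Jm'.
- apply: (radical_sigma_homogeneous (@gr_var_V 2 K)) => P m m' IP _ pm pm' Jm Jm'.
  by have [] := h P m m' IP pm pm' Jm Jm'.
Qed.

(** Here the [L]-weight alone separates the monomials left over. *)
Lemma above_slope_homogeneous : a%:R < s * (b%:R - a%:R) ->
  homogeneous_ideal (@gr_F 2) J /\ homogeneous_ideal (@gr_V 2) J.
Proof.
move=> hs; apply: bihomogeneous_radical => P m m' _ pm pm' Jm Jm'.
have := initial_form_weight pm pm'.
rewrite /w !mnm_weight_L !mnm_weight_F !mnm_weight_V.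
rewrite (notin_radical_xi xi1_radical Jm) (notin_radical_xi xi1_radical Jm').
rewrite (notin_radical_xi (xi2_radical hs) Jm) (notin_radical_xi (xi2_radical hs) Jm').
rewrite !add0n !mul1r !rmorphB /= -!pmulrn => e.
have [-> ->//] := conormal_weights (notin_radical_conormal (x3xi3_radical hs) Jm)
  (notin_radical_conormal (x3xi3_radical hs) Jm') e.
Qed.

(* The weight of [t] for which [t ^ a] is exactly as heavy as [xi_2]. *)
Let tau : R := s / a%:R.

Lemma tau_a : tau *+ a = s.
Proof. by rewrite -mulr_natr divfK // pnatr_eq0; lia. Qed.

(** Since [a > 1], the variable [t] is lighter than [xi_1]. *)
Lemma tau_lt1 : tau < s.
Proof.
rewrite /tau ltr_pdivrMr ?ltr0n; last lia.
by rewrite ltr_pMr // ltr1n.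
Qed.

Let a0 : 0 < a%:R :> R.
Proof. by rewrite ltr0n; lia. Qed.

Lemma tau_b : (tau *+ b) * a%:R = s * b%:R.
Proof. by rewrite -[tau *+ b]mulr_natr mulrAC divfK // lt0r_neq0. Qed.

Lemma tau_b_le : s * (b%:R - a%:R) <= a%:R -> tau *+ b <= s + 1.
Proof. by move=> hs; rewrite -(ler_pM2r a0) tau_b; lra. Qed.

Lemma tau_b_lt : s * (b%:R - a%:R) < a%:R -> tau *+ b < s + 1.
Proof. by move=> hs; rewrite -(ltr_pM2r a0) tau_b; lra. Qed.

Lemma tau_b_eq : s * (b%:R - a%:R) = a%:R -> tau *+ b = s + 1.
Proof. by move=> hs; apply: (mulIf (lt0r_neq0 a0)); rewrite tau_b; lra. Qed.

Lemma tau_le i : s * (b%:R - a%:R) <= a%:R -> tau *+ tnth A i <= w (rshift 3 i).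
Proof.
move=> hs; have [->|->|->] := ord3P i; rewrite tnthA.
- by rewrite weight_xi1 ltW // tau_lt1.
- by rewrite weight_xi2 tau_a.
- by rewrite weight_xi3 tau_b_le.
Qed.

Local Notation top_var := (@top_curve_var 3 K R A w tau).
Local Notation top_subst := (@top_curve_subst 3 K R A w tau).

(** The summand of [x_1 xi_1] never has top weight, that of [x_2 xi_2] does up
    to the critical value of [s], and that of [x_3 xi_3] only at this value. *)
Lemma top_curve_subst_euler : s * (b%:R - a%:R) <= a%:R ->
  top_subst (euler_form K A) =
  'X_(rshift 3 ord0) ^+ a * 'X_(lshift 1 i2) *+ a +
  'X_(lshift 1 i3) * top_var (rshift 3 i3) *+ b.
Proof.
move=> hs; rewrite /euler_form big_ord3 /= !rmorphD /= !rmorphMn !rmorphM /=.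
rewrite /top_curve_subst !mmapX !mmap1U.
rewrite /top_curve_var.
rewrite -![lshift _ _]/(unsplit (inl _)) -![rshift _ _]/(unsplit (inr _)) !unsplitK /=.
rewrite weight_xi1 weight_xi2 tau_a eqxx (lt_eqF tau_lt1).
by rewrite mulr0 mul0rn add0r ['X_(_) * _ ^+ _]mulrC.
Qed.

Lemma top_curve_subst_euler_neq0 : s * (b%:R - a%:R) <= a%:R ->
  top_subst (euler_form K A) != 0.
Proof.
move=> hs; rewrite top_curve_subst_euler //.
(* At [x_3 = 0] and all other coordinates 1 only the summand of [x_2] survives. *)
pose v (k : 'I_(3 + 1)) : K := (k != lshift 1 i3)%:R.
apply/eqP => /(congr1 (meval v)).
rewrite meval0 mevalD !mevalMn !mevalM rmorphXn /= !mevalXU /v eqxx mul0r mul0rn.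
rewrite addr0 eq_rlshift eq_lshift /= expr1n mulr1 => /eqP.
by rewrite pnatr_eq0; lia.
Qed.

(** The monomials of an initial form along the conormal space of [x_2 = 0]
    keep distinct images under the substitution [xi_2 = t^a], so none of them
    survives the divisibility by [x_2]. *)
Lemma below_slope_x2 (P : weyl 3 K) m : s * (b%:R - a%:R) < a%:R -> I P ->
  m \in msupp (initial_form w (symb P)) ->
  m (rshift 3 ord0) = 0%N -> m (rshift 3 i3) = 0%N -> m (lshift 3 i2) != 0%N.
Proof.
move=> hs IP pm m1 m3; have hs' := ltW hs; apply/negP => /eqP m2.
have [r] := initial_form_euler_multiple s_gt0 (weyl_L_euler s)
  (fun i => tau_le i hs') IP (top_curve_subst_euler_neq0 hs').
set p := initial_form _ _ in pm *.
rewrite top_curve_subst_euler //.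
have top3 : top_var (rshift 3 i3) = 0.
  rewrite /top_curve_var -[rshift _ _]/(unsplit (inr _)) unsplitK.
  by rewrite weight_xi3 tnthA (lt_eqF (tau_b_lt hs)).
have top1 : top_var (rshift 3 ord0) = 0.
  rewrite /top_curve_var -[rshift _ _]/(unsplit (inr _)) unsplitK.
  by rewrite weight_xi1 tnthA (lt_eqF tau_lt1).
have top2 : top_var (rshift 3 i2) = 'X_(rshift 3 ord0) ^+ a.
  rewrite /top_curve_var -[rshift _ _]/(unsplit (inr _)) unsplitK.
  by rewrite weight_xi2 tnthA tau_a eqxx.
have topx i : top_var (lshift 3 i) = 'X_(lshift 1 i).
  by rewrite /top_curve_var -[lshift _ _]/(unsplit (inl _)) unsplitK.
(* Forgetting the exponents of [xi_1] and [xi_3] loses nothing, as they vanish. *)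
pose phi (m : 'X_{1..3 + 3}) : 'X_{1..3 + 1} :=
  [multinom match split k with
            | inl i => m (lshift 3 i)
            | inr _ => a * m (rshift 3 i2)
            end | k < 3 + 1]%N.
have phix m' i : phi m' (lshift 1 i) = m' (lshift 3 i).
  by rewrite mnmE -[lshift _ _]/(unsplit (inl _)) unsplitK.
have phit m' : phi m' (rshift 3 ord0) = (a * m' (rshift 3 i2))%N.
  by rewrite mnmE -[rshift _ _]/(unsplit (inr _)) unsplitK.
have topX m' : mmap1 (top_var) m' =
    if (m' (rshift 3 ord0) == 0%N) && (m' (rshift 3 i3) == 0%N)
    then 'X_[phi m'] else 0.
  rewrite /mmap1 big_split_ord /= [X in _ * X]big_ord3 /= top1 top2 top3 !expr0n.
  case: eqP => _ /=; last by rewrite mul0r mulr0.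
  case: eqP => _ /=; last by rewrite !mulr0.
  rewrite mul1r mulr1 -exprM [in RHS]mpolyXE_id big_split_ord /= big_ord1.
  rewrite phit; congr (_ * _); apply: eq_bigr => i _.
  by rewrite topx phix.
move=> /(congr1 (mcoeff (phi m))).
have -> : (top_subst p)@_(phi m) = p@_m.
  rewrite /top_curve_subst /mmap raddf_sum /= (bigD1_seq m) ?msupp_uniq //=.
  rewrite topX m1 m3 !eqxx /= mcoeffCM mcoeffX eqxx mulr1 big1 ?addr0 // => m' mm'.
  rewrite mcoeffCM topX; case: ifP => [/andP[/eqP m1' /eqP m3']|]; last first.
    by rewrite mcoeff0 mulr0.
  rewrite mcoeffX; case: eqP => [e|]; last by rewrite mulr0.
  case/eqP: mm'; apply: mnmP2 => i; first by rewrite -!phix e.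
  have [->|->|->] := ord3P i; rewrite ?m1 ?m1' ?m3 ?m3' //.
  by apply/eqP; rewrite -(eqn_pmul2l (ltnW a_gt1)) -!phit e.
rewrite top3 mulr0 mul0rn addr0 mulrnAl [_ ^+ _ * 'X_(_)]mulrC -mulrA -mulrnAr.
by rewrite mcoeff_XM0 ?phix // => /eqP; rewrite -[_ == _]negbK -mcoeff_msupp pm.
Qed.

(** The monomials left over involve no [xi] at all, so their [F]-degree is
    zero and the [L]-weight gives the [V]-degree. *)
Lemma below_slope_homogeneous : s * (b%:R - a%:R) < a%:R ->
  homogeneous_ideal (@gr_F 2) J /\ homogeneous_ideal (@gr_V 2) J.
Proof.
move=> hs.
have no_xi P m : I P -> m \in msupp (initial_form w (symb P)) ->
    ~ J (to_gr_germ 'X_[m]) -> [/\ m (rshift 3 ord0) = 0%N,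
      m (rshift 3 i2) = 0%N & m (rshift 3 i3) = 0%N].
  move=> IP pm Jm; have m1 := notin_radical_xi xi1_radical Jm.
  have m3 := notin_radical_xi (xi3_radical hs) Jm; split; [exact: m1| |exact: m3].
  have := below_slope_x2 hs IP pm m1 m3.
  by case: (notin_radical_conormal (x2xi2_radical hs) Jm) => ->.
apply: bihomogeneous_radical => P m m' IP pm pm' Jm Jm'; have := initial_form_weight pm pm'.
rewrite /w !mnm_weight_L !mnm_weight_F !mnm_weight_V.
have [-> -> ->] := no_xi P m IP pm Jm; have [-> -> ->] := no_xi P m' IP pm' Jm'.
rewrite !mul1r => /addrI; rewrite !sub0r !rmorphN /= -!pmulrn => /oppr_inj.
by move=> /eqP; rewrite eqr_nat => /eqP ->.
Qed.

Let z (i : 'I_3) : K := (i != ord0)%:R.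

(** The point with [x = 0] and [xi = (0, 1, 1)] is the image of [x = 0], [t = 1]
    under the reduced substitution, in which [xi_1] goes to zero because [t] is
    lighter. *)
Lemma critical_initial_form_eval (P : weyl 3 K) : s * (b%:R - a%:R) = a%:R -> I P ->
  (initial_form w (symb P)).@[conormal_point z] = 0.
Proof.
move=> hs IP; have hs' : s * (b%:R - a%:R) <= a%:R by rewrite hs.
pose v (k : 'I_(3 + 1)) : K := match split k with inl _ => 0 | inr _ => 1 end.
have vx i : v (lshift 1 i) = 0.
  by rewrite /v -[lshift _ _]/(unsplit (inl _)) unsplitK.
have vt i : v (rshift 3 i) = 1.
  by rewrite /v -[rshift _ _]/(unsplit (inr _)) unsplitK.
have vtop k : (top_var k).@[v] = conormal_point z k.
  rewrite /top_curve_var /conormal_point; case: split_ordP => i _.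
    by rewrite mevalXU vx.
  rewrite /z; have [->|->|->] := ord3P i; rewrite tnthA.
  - by rewrite weight_xi1 (lt_eqF tau_lt1) meval0.
  - by rewrite weight_xi2 tau_a eqxx rmorphXn /= mevalXU vt expr1n.
  - by rewrite weight_xi3 (tau_b_eq hs) eqxx rmorphXn /= mevalXU vt expr1n.
have [r] := initial_form_euler_multiple s_gt0 (weyl_L_euler s)
  (fun i => tau_le i hs') IP (top_curve_subst_euler_neq0 hs').
move=> /(congr1 (meval v)); rewrite mevalM top_curve_subst_euler //.
rewrite mevalD !mevalMn !mevalM !mevalXU !vx mulr0 mul0r !mul0rn addr0 mul0r => <-.
rewrite [LHS]mevalE /top_curve_subst /mmap [RHS]raddf_sum; apply: eq_bigr => m _.
rewrite /= mevalM mevalC /mmap1 rmorph_prod /=; congr (_ * _); apply: eq_bigr => k _.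
by rewrite rmorphXn /= vtop.
Qed.

(** The binomial [xi_2 ^ b - xi_3 ^ a] lies in the radical and vanishes at the
    point [xi = (0, 1, 1)], but its component [xi_2 ^ b] does not. *)
Lemma critical_not_homogeneous : s * (b%:R - a%:R) = a%:R ->
  ~ homogeneous_ideal (@gr_F 2) J.
Proof.
move=> hs hom.
have [P [IP symbP]] : exists P, I P /\
    symb P = 'X_(rshift 3 i2) ^+ b - 'X_(rshift 3 i3) ^+ a.
  by apply: binomial_hypergeometric; rewrite !tnthA mulnC.
have h2 : homogeneous_of w (s *+ b) ('X_(rshift 3 i2) ^+ b : {mpoly K[3 + 3]}).
  by rewrite -weight_xi2; apply/homogeneous_of_exp/homogeneous_ofU.
have h3 : homogeneous_of w (s *+ b) ('X_(rshift 3 i3) ^+ a : {mpoly K[3 + 3]}).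
  have -> : s *+ b = (s + 1) *+ a.
    by rewrite -[LHS]mulr_natr -[RHS]mulr_natr; lra.
  by rewrite -weight_xi3; apply/homogeneous_of_exp/homogeneous_ofU.
have hP : homogeneous_of w (s *+ b) (symb P).
  by rewrite symbP -scaleN1r; apply/homogeneous_ofD/homogeneous_ofZ.
have P0 : symb P != 0.
  apply/eqP => /(congr1 (meval (fun k => (k == rshift 3 i2)%:R))).
  rewrite symbP meval0 mevalB !rmorphXn /= !mevalXU eqxx expr1n eq_rshift /=.
  rewrite expr0n (_ : (a == 0)%N = false) ?subr0; last by apply/eqP; lia.
  by move=> /eqP; rewrite oner_eq0.
have inP : initial_form w (symb P) = symb P.
  have e : wcomp w (s *+ b) (symb P) = symb P by rewrite (wcomp_homogeneous _ hP) eqxx.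
  by rewrite (initial_formE (homogeneous_ofW hP)) e ?P0.
have JP : J (to_gr_germ (symb P)).
  rewrite -inP; apply: (initial_form_sigma w IP).
  by apply: contraNneq P0 => ->; rewrite raddf0.
have F1 i : @gr_F 2 (rshift 1 i) = 1.
  by rewrite /gr_F -[rshift _ _]/(unsplit (inr _)) unsplitK.
have Fexp i j : homogeneous_of (@gr_F 2) j%:Z
    ('X_(rshift 1 i) ^+ j : {mpoly (cps 2 K)[1 + 3]}).
  rewrite -[j%:Z]natz -(F1 i); exact/homogeneous_of_exp/homogeneous_ofU.
have := hom _ b%:Z JP.
rewrite -[weighted_component _ _ _]/(wcomp (@gr_F 2) b%:Z _) symbP to_gr_germB.
rewrite !rmorphXn /= !to_gr_germ_xi raddfB /= !(wcomp_homogeneous _ (@Fexp _ _)).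
rewrite eqxx (_ : (a%:Z == b%:Z) = false) ?subr0; last by apply/negbTE; lia.
move=> /(germ_eval_sigma (fun P => @critical_initial_form_eval P hs)) /eqP.
rewrite rmorphXn /= germ_evalX -[rshift _ _]/(unsplit (inr _)) unsplitK /z.
by rewrite expr1n oner_eq0.
Qed.

End ThreeVariables.

Theorem theorem4p7 (R : realType) (a b : nat) (beta : R[i])
    (ha : (1 < a)%N) (hab : (a < b)%N) :
  geometric_slopes (hypergeometric_ideal [tuple 1%N; a; b] beta) =
  [set a%:R / (a%:R - b%:R) : R].
Proof.
have ba : 0 < b%:R - a%:R :> R by rewrite subr_gt0 ltr_nat.
have a0 : 0 < a%:R :> R by rewrite ltr0n; lia.
have ab0 : a%:R - b%:R != 0 :> R by rewrite -opprB oppr_eq0 lt0r_neq0.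
apply/seteqP; split=> r.
  move=> [r0 nh]; have s0 : 0 < - r by rewrite oppr_gt0.
  case: (ltgtP (- r * (b%:R - a%:R)) a%:R) => [lt|gt|eq].
  - by case: nh; apply: below_slope_homogeneous.
  - by case: nh; apply: above_slope_homogeneous.
  - by apply: (mulIf ab0); rewrite divfK //; lra.
move=> /= ->.
have s0 : 0 < - (a%:R / (a%:R - b%:R)) :> R.
  by rewrite -mulrN -invrN opprB divr_gt0.
split; first by rewrite -oppr_gt0.
move=> J [hom _]; apply: (critical_not_homogeneous ha hab s0 _ hom).
by rewrite -mulrN -invrN opprB divfK // lt0r_neq0.
Qed.
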